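(* Let $\mu$ be a quasi-Bernoulli independent random measure on $\mathbb{A}$, and assume that $\tau_\mu$ is twice continuously differentiable. Let $J=\{q\in\mathbb{R}:\tau_\mu'(q)q-\tau_\mu(q)>0\}$. Let $N\ge 1$ be an integer and let $\widetilde\varepsilon=(\varepsilon_n)_{n\ge 1}$ be a sequence of positive numbers going to $0$. Assume that for all $M>0$ and $\alpha>0$ the series $$\sum_{n\ge 1} b^{Mn^{3/4}\log (n)}\,b^{-n\alpha\varepsilon_n^2}$$ converges. Then, with probability one, for every $q\in J$, the sets $E^{\mu_q}_{\tau_\mu'(q)q-\tau_\mu(q)}(N,\widetilde\varepsilon)$ and $E^{\mu}_{\tau_\mu'(q)}(N,\widetilde\varepsilon)$ are both of full $\mu_q$-measure.
   Context: **Symbolic space.** $b\ge 2$ is an integer, $\mathcal{A}=\{0,\dots,b-1\}$, $\mathcal{A}^*=\bigcup_{n\ge1}\mathcal{A}^n$, and $\mathbb{A}=\mathcal{A}^{\{1,2,3,\dots\}}$ with the product topology. For a finite word $w$ of length $n$, $[w]\subset\mathbb{A}$ is the cylinder of sequences whose first $n$ letters form $w$; for $t\in\mathbb{A}$, $t|n=t_1\cdots t_n$. $\ell$ is the measure on $\mathbb{A}$ with $\ell([w])=b^{-n}$ for $w\in\mathcal{A}^n$. For $w\in\mathcal{A}^n$, $i(w)\in\{0,\dots,b^n-1\}$ is the integer with $i(w)b^{-n}=\sum_{k=1}^n w_kb^{-k}$; for $v,w\in\mathcal{A}^n$, $\delta(v,w)=|i(v)-i(w)|$. All random variables are defined on a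 probability space $(\Omega,\mathcal{B},\mathbb{P})$. **Quasi-Bernoulli independent random measure.** A random probability measure $\mu=\mu(\omega)$ on $\mathbb{A}$ is a quasi-Bernoulli independent random measure if there exist a constant $C>0$ and two sequences of random measures $(\mu_j)_{j\ge1}$ and $(\mu^{(j)})_{j\ge1}$ on $\mathbb{A}$ such that for every $j\ge1$: (P1) for all $(v,w)\in\mathcal{A}^j\times\mathcal{A}^*$, $\frac1C\mu_j([v])\mu^{(j)}([w])\le\mu([vw])\le C\mu_j([v])\mu^{(j)}([w])$; (P2) for every $r\in\{0,\dots,b-1\}$, $0<\operatorname{ess\,inf}\mu([r])\le\operatorname{ess\,sup}\mu([r])<\infty$; (P3) $(\mu^{(j)}([w]))_{w\in\mathcal{A}^*}$ and $(\mu([w]))_{w\in\mathcal{A}^*}$ have the same distribution; $\mu$ is also denoted $\mu^{(0)}$; (P4) the $\sigma$-algebras $\sigma(\mu_j([v]):v\in\mathcal{A}^j)$ and $\sigma(\mu^{(j)}([w]):w\in\mathcal{A}^* )$ are independent. **The function $\tau_\mu$.** $\tau_\mu(q)=\liminf_{j\to\infty}-\frac1j\log_b\sum_{w\in\mathcal{A}^j}\mu([w])^q$ for $q\in\mathbb{R}$. With probability one this is a limit for all $q\in\mathbb{R}$, and $\tau_\mu$ is a deterministic real-valued function of $q$. **Auxiliary measures $\mu_q$.** For $\omega$ in an event of probability one, for $q\in\mathbb{R}$ and $n\ge1$, let $\mu_{q,n}$ be the probability measure on $\mathbb{A}$ whose density with respect to $\ell$ is constant on each cylinder $[v]$, $v\in\mathcal{A}^n$,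 and proportional there to $\mu([v])^q$; so $\mu_{q,n}([v])=\mu([v])^q/\sum_{u\in\mathcal{A}^n}\mu([u])^q$. The measure $\mu_q$ is a weak limit of some subsequence of $(\mu_{q,n})_n$ (a choice of such a limit is fixed for each $q$ and $\omega$). **Singularity sets.** For a probability measure $\nu$ on $\mathbb{A}$, $\beta\ge0$, an integer $N$, and a positive sequence $\widetilde\varepsilon=(\varepsilon_n)$, for $p\ge1$ let $E^{\nu}_{\beta,p}(N,\widetilde\varepsilon)$ be the set of $t\in\mathbb{A}$ such that for all $n\ge p$, all $\gamma\in\{-1,1\}$ and all $w\in\mathcal{A}^n$ with $\delta(w,t|n)\le N$, $b^{\gamma n(\beta-\gamma\varepsilon_n)}\nu([w])^\gamma\le1$ (equivalently $b^{-n(\beta+\varepsilon_n)}\le\nu([w])\le b^{-n(\beta-\varepsilon_n)}$). Let $E^{\nu}_\beta(N,\widetilde\varepsilon)=\bigcup_{p\ge1}E^{\nu}_{\beta,p}(N,\widetilde\varepsilon)$. *)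

(* Defs.v *)
From HB Require Import structures.
From mathcomp Require Import all_boot all_order all_algebra.
From mathcomp Require Import all_classical all_reals all_analysis.
From mathcomp Require Import measurable_realfun ess_sup_inf.

Set Implicit Arguments.
Unset Strict Implicit.
Unset Printing Implicit Defensive.

Import Order.TTheory GRing.Theory Num.Theory.
Import numFieldNormedType.Exports.

Local Open Scope classical_set_scope.
Local Open Scope ring_scope.

(* The letter t_k of a sequence t (k >= 1) is [t k.-1].  The proof [hb] is
   only used to make the type pointed, as measurable types have to be. *)
Definition symb (b : nat) (hb : (1 < b)%N) : Type := nat -> 'I_b.

Section symbolic_topology.
Variables (b : nat) (hb : (1 < b)%N).

Let symb_prod : Type := prod_topology (fun _ : nat => discrete_topology 'I_b).

HB.instance Definition _ := Choice.copy (symb hb) symb_prod.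
HB.instance Definition _ :=
  isPointed.Build (symb hb) (fun _ => Ordinal (ltnW hb)).
HB.instance Definition _ := Topological.copy (symb hb) symb_prod.
HB.instance Definition _ := Measurable.copy (symb hb)
  (g_sigma_algebraType (@open (symb hb))).

End symbolic_topology.

Section words.
Variables (b : nat) (hb : (1 < b)%N).

Definition head_word (t : symb hb) (n : nat) : n.-tuple 'I_b :=
  [tuple t i | i < n].

Definition cyl (w : seq 'I_b) : set (symb hb) :=
  [set t | head_word t (size w) = w :> seq 'I_b].

(* i(w) = b^n * \sum_(1 <= k <= n) w_k b^(-k). *)
Definition word_index (n : nat) (w : n.-tuple 'I_b) : nat :=
  (\sum_(k < n) tnth w k * b ^ (n - k.+1))%N.

Definition word_dist (n : nat) (v w : n.-tuple 'I_b) : nat :=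
  `|(word_index v)%:Z - (word_index w)%:Z|%N.

Lemma cylE n (w : n.-tuple 'I_b) : cyl w = [set t | head_word t n = w].
Proof.
case: w => w wn; have /eqP ? := wn; subst n; apply/seteqP; split=> t /=.
  by move=> tw; exact: val_inj.
by move/(congr1 val).
Qed.

Lemma open_cyl n (w : n.-tuple 'I_b) : open (cyl w).
Proof.
rewrite cylE openE => t /= tw; rewrite /interior.
have Ft k : nbhs t [set s : symb hb | s k = t k].
  exact: (@proj_continuous nat (fun _ => discrete_topology 'I_b) k t [set t k]
    (@discrete_set1 (discrete_topology 'I_b) (t k))).
have Fn : nbhs t [set s : symb hb | forall i : 'I_n, s i = t i].
  exact: (@filter_forall (symb hb) 'I_n
    (fun i => [set s : symb hb | s i = t i]) _ (nbhs_filter t) (fun i => Ft i)).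
move: Fn; apply: (@filterS _ (nbhs t)) => s /= st; rewrite -tw.
by apply: eq_from_tnth => i; rewrite !tnth_mktuple; exact: st.
Qed.

Lemma measurable_cyl n (w : n.-tuple 'I_b) : measurable (cyl w).
Proof. by apply: sub_sigma_algebra; exact: open_cyl. Qed.

Lemma open_head_word (n : nat) (T : Type) (g : n.-tuple 'I_b -> T) (Y : set T) :
  open [set t : symb hb | Y (g (head_word t n))].
Proof.
rewrite openE => t /= Yt; rewrite /interior.
have : nbhs t (cyl (head_word t n)).
  by apply: open_nbhs_nbhs; split; [exact: open_cyl|rewrite cylE].
by apply: filterS => s; rewrite cylE /= => ->.
Qed.

End words.

Section gibbs.
Context {R : realType} (b : nat) (hb : (1 < b)%N).
Variable m : {measure set (symb hb) -> \bar R}.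

Definition partition_sum (q : R) (n : nat) : R :=
  \sum_(w : n.-tuple 'I_b) fine (m (cyl w)) `^ q.

Definition tau_of (q : R) : \bar R :=
  limn_einf (fun j : nat =>
    (- (j%:R^-1 * (ln (partition_sum q j) / ln b%:R)))%:E).

(* The factor b^n is 1 / ell [t|n], so that the total mass is 1. *)
Definition gibbs_density (q : R) (n : nat) (t : symb hb) : R :=
  b%:R ^+ n * (fine (m (cyl (head_word t n))) `^ q / partition_sum q n).

Definition gibbs (ell : {measure set (symb hb) -> \bar R}) (q : R) (n : nat)
  (B : set (symb hb)) : \bar R :=
  (\int[ell]_(t in B) (gibbs_density q n t)%:E)%E.

Lemma gibbs_density_ge0 q n t : 0 <= gibbs_density q n t.
Proof.
rewrite mulr_ge0 ?exprn_ge0// divr_ge0 ?powR_ge0//.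
by apply: sumr_ge0 => w _; exact: powR_ge0.
Qed.

Lemma measurable_gibbs_density q n :
  measurable_fun [set: symb hb] (gibbs_density q n).
Proof.
move=> _ Y mY; rewrite setTI; apply: sub_sigma_algebra.
exact: (@open_head_word b hb n _
  (fun w => b%:R ^+ n * (fine (m (cyl w)) `^ q / partition_sum q n)) Y).
Qed.

Variable ell : {measure set (symb hb) -> \bar R}.
Variables (q : R) (n : nat).

Let gibbs0 : gibbs ell q n set0 = 0%E.
Proof. by rewrite /gibbs integral_set0. Qed.

Let gibbs_ge0 B : (0 <= gibbs ell q n B)%E.
Proof.
by apply: integral_ge0 => t _; rewrite lee_fin; exact: gibbs_density_ge0.
Qed.

Let gibbs_sigma_additive : semi_sigma_additive (gibbs ell q n).
Proof.
move=> /= F mF tF mUF; rewrite /gibbs; apply: cvg_toP.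
  apply: ereal_nondecreasing_is_cvgn => i j ij.
  apply: lee_sum_nneg_natr => // k _ _; apply: integral_ge0 => /= x Fkx.
  by rewrite lee_fin gibbs_density_ge0.
rewrite ge0_integral_bigcup//=.
- apply/measurable_EFinP/measurable_funTS.
  exact: measurable_gibbs_density.
- by move=> x _; rewrite lee_fin gibbs_density_ge0.
Qed.

HB.instance Definition _ := isMeasure.Build _ _ _
  (gibbs ell q n) gibbs0 gibbs_ge0 gibbs_sigma_additive.

Lemma gibbs_cyl (v : n.-tuple 'I_b) : ell (cyl v) = (b%:R ^- n)%:E ->
  gibbs ell q n (cyl v) =
    (fine (m (cyl v)) `^ q / partition_sum q n)%:E.
Proof.
move=> ellv; rewrite /gibbs.
rewrite (eq_integral (cst (b%:R ^+ n *
    (fine (m (cyl v)) `^ q / partition_sum q n))%:E)); last first.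
  by move=> t; rewrite inE {1}cylE /= => tv; rewrite /gibbs_density tv.
rewrite integral_cst ?ellv; last exact: measurable_cyl.
rewrite -EFinM; congr (_%:E); rewrite mulrAC divff ?mul1r//.
by apply: expf_neq0; rewrite pnatr_eq0 -lt0n ltnW.
Qed.

End gibbs.

Definition weak_subseq_limit {R : realType} (b : nat) (hb : (1 < b)%N)
    (nu_ : nat -> {measure set (symb hb) -> \bar R})
    (nu : {measure set (symb hb) -> \bar R}) : Prop :=
  exists phi : nat -> nat, {homo phi : i j / (i < j)%N} /\
    forall f : symb hb -> R, continuous f ->
      (\int[nu_ (phi k)]_t (f t)%:E)%E @[k --> \oo] -->
      (\int[nu]_t (f t)%:E)%E.

Definition nonempty_word (b : nat) : Type := {w : seq 'I_b | w != [::]}.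

Section families.
Context {R : realType} {I T : Type}.

Definition generated_sigma (X : I -> T -> \bar R) : set (set T) :=
  <<s \bigcup_i preimage_set_system setT (X i) measurable >>.

End families.

Section random_families.
Context d {Om : measurableType d} {R : realType}.
Variable P : probability Om R.

(* Equality of the laws on the product sigma-algebra of \bar R ^ I, which is
   the one generated by the coordinate maps. *)
Definition same_distribution (I : Type) (X Y : I -> Om -> \bar R) : Prop :=
  forall B : set (I -> \bar R),
    generated_sigma (fun (i : I) (f : I -> \bar R) => f i) B ->
    P [set x | B (X ^~ x)] = P [set x | B (Y ^~ x)].

Definition independent_sigma (F G : set (set Om)) : Prop :=
  forall A B, F A -> G B -> P (A `&` B) = (P A * P B)%E.

(* Random measures are kernels from the probability space to [symb hb];
   [muL j] is mu_j and [muR j] is mu^(j). *)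
Definition quasi_bernoulli (b : nat) (hb : (1 < b)%N)
    (mu : R.-pker Om ~> symb hb) : Prop :=
  exists (C : R) (muL muR : nat -> R.-ker Om ~> symb hb), 0 < C /\
  forall j : nat, (0 < j)%N ->
  [/\ \forall x \ae P, forall (v : j.-tuple 'I_b) (w : nonempty_word b),
        (C^-1%:E * muL j x (cyl v) * muR j x (cyl (val w))
           <= mu x (cyl (v ++ val w)) /\
         mu x (cyl (v ++ val w))
           <= C%:E * muL j x (cyl v) * muR j x (cyl (val w)))%E,
      forall r : 'I_b,
        (0 < ess_inf P (fun x => mu x (cyl [:: r])) /\
         ess_inf P (fun x => mu x (cyl [:: r]))
           <= ess_sup P (fun x => mu x (cyl [:: r])) /\
         ess_sup P (fun x => mu x (cyl [:: r])) < +oo)%E,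
      same_distribution
        (fun (w : nonempty_word b) x => muR j x (cyl (val w)))
        (fun (w : nonempty_word b) x => mu x (cyl (val w))) &
      independent_sigma
        (generated_sigma (fun (v : j.-tuple 'I_b) x => muL j x (cyl v)))
        (generated_sigma
           (fun (w : nonempty_word b) x => muR j x (cyl (val w))))].

End random_families.

Section singularity.
Context {R : realType} (b : nat) (hb : (1 < b)%N).
Variables (nu : {measure set (symb hb) -> \bar R}) (beta : R) (N : nat).
Variable eps : nat -> R.

(* Both signs gamma = 1, -1 are written out as the two inequalities, since
   [0 `^ (-1) = 0] would make the condition for gamma = -1 void on null
   cylinders. *)
Definition singularity_set_from (p : nat) : set (symb hb) :=
  [set t | forall n, (p <= n)%N -> forall w : n.-tuple 'I_b,
     (word_dist w (head_word t n) <= N)%N ->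
     ((b%:R `^ (- (n%:R * (beta + eps n))))%:E <= nu (cyl w) /\
      nu (cyl w) <= (b%:R `^ (- (n%:R * (beta - eps n))))%:E)%E].

Definition singularity_set : set (symb hb) :=
  \bigcup_(p in [set p | (1 <= p)%N]) singularity_set_from p.

End singularity.

(* Main.v *)
From HB Require Import structures.
Require Import Defs.
From mathcomp Require Import all_boot all_order all_algebra.
From mathcomp Require Import all_classical all_reals all_analysis.
From mathcomp Require Import measurable_realfun ess_sup_inf.
From mathcomp Require Import zify ring lra.
Import Order.TTheory GRing.Theory Num.Theory.
Import numFieldNormedType.Exports.
Set Implicit Arguments.
Unset Strict Implicit.
Unset Printing Implicit Defensive.
Local Open Scope classical_set_scope.
Local Open Scope ring_scope.

(** Why the theorem holds.

    Write [p(w)] for the mass of the cylinder of a word [w] under one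
    realization of [mu], and [S_n(q)] for the sum of the [p(w) ^ q] over the
    words of length [n].  Almost surely [p(v w)] is, up to a constant factor,
    the product of [p(v)] and of a number [g_j(w)] that depends on [v] only
    through its length [j], so that [S_(j+k)(q)] is comparable to [S_j(q)] times
    the sum of the [g_j(w) ^ q].  That second factor disappears from the ratios
    that define the Gibbs measures: their weak limit [mu_q] satisfies, for every
    word [w] of length [n] and up to a constant independent of [n],
    [mu_q([w]) = p(w) ^ q / S_n(q)] ([gibbs_limit_mass]).

    The first ingredient is probabilistic: almost surely, uniformly for [q] in
    a bounded set, [ln S_n(q) = - n tau(q) ln b + O(n^(3/4) ln n)].  Indeed
    [ln S_(j+k)(q)] is, up to a bounded error, the sum of two independent
    variables, one close to [ln S_j(q)] and the other distributed like
    [ln S_k(q)].  Hence the exponential moments of [ln S_n(q)] are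
    submultiplicative up to constants, and cutting [n] into about [sqrt n] blocks
    of length about [sqrt n] gives fluctuations of size [n^(3/4) ln n] with
    probability at most a multiple of [n^(-3)] ([quasi_additive_deviation]).  As
    [ln S_n] is Lipschitz in [q] with constant of order [n], a union bound over a
    grid of mesh [1 / n] and the Borel-Cantelli lemma make this uniform in [q]
    ([uniform_deviation]).  The definition of [tau] identifies the limit of
    [ln S_n(q) / n] ([tau_of_limit]).

    From there on a realization and [q] are fixed.  Under [mu_q], Chernoff's
    inequality with parameter [eta] bounds the probability that [ln p(t|n)]
    exceeds [- n tau'(q) ln b] by [n e ln b], where [e] is proportional to
    [eps_n], by the exponential of
    [n ln b (tau(q) - tau(q + eta) + eta tau'(q) - eta e)], up to an error
    [O(n^(3/4) ln n)] in the exponent.  Taylor's formula and a choice of [eta]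
    proportional to [e] turn it into [- alpha n eps_n^2 + O(n^(3/4) ln n)], and
    the assumption on the series makes these probabilities summable.  The other
    sign is similar.

    It remains to treat the neighbours [w] of [t|n].  If [w] and [t|n] differ
    before their last [k] letters, a carry goes through these [k] letters of
    [t|n], which leaves at most [2 N] possibilities for them
    ([far_prefix_tail], [card_extremal_tails]).  Each letter keeps only a
    fraction at most [1 - kappa] of the [mu_q]-mass ([gibbs_limit_decay]), so
    this has probability at most [2 N (1 - kappa) ^ k].  With [k] a small
    multiple of [n eps_n] this is summable, while two words with the same prefix
    of length [n - k] have masses whose logarithms differ by at most a small
    multiple of [n eps_n] ([level_set_typical]).  This gives the singularity set
    of [mu]; that of [mu_q] follows since [ln mu_q([w])] is
    [q ln p(w) - ln S_n(q)] up to a constant ([gibbs_limit_typical]). *)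

(** * Quasi-additive sequences *)

(** [u n + c] is subadditive and [u n - c] superadditive, so that
    [(u j - c) / j <= (u k + c) / k] for all [j] and [k].  A number separating
    these two families is the limit of [u n / n], with the error [c / n]. *)
Lemma quasi_additive_limit (R : realType) (u : nat -> R) (c : R) :
  (forall j k, (0 < j)%N -> (0 < k)%N -> `|u (j + k)%N - u j - u k| <= c) ->
  exists a, forall n, (0 < n)%N -> `|u n - n%:R * a| <= c.
Proof.
move=> uc; have c0 : 0 <= c := le_trans (normr_ge0 _) (uc 1%N 1%N isT isT).
have lin j k : (0 < j)%N -> (0 < k)%N ->
    k%:R * u j - k%:R * c <= u (k * j)%N - c /\
    u (k * j)%N + c <= k%:R * u j + k%:R * c.
  move=> j0; elim: k => // k IH _.
  have [->|k0] := posnP k; first by rewrite mul1n !mul1r; split; lra.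
  have [h1 h2] := IH k0.
  have := uc (k * j)%N j; rewrite muln_gt0 k0 j0 => /(_ isT isT).
  rewrite addnC -mulSn => /ler_normlP[h3 h4].
  by rewrite -natr1 !mulrDl !mul1r; split; lra.
pose S := [set (u n.+1 - c) / n.+1%:R | n in [set: nat]].
have S0 : S !=set0 by exists ((u 1%N - c) / 1%:R); exists 0%N.
have ubS k : (0 < k)%N -> ubound S ((u k + c) / k%:R).
  move=> k0 _ [n _ <-].
  rewrite ler_pdivrMr ?ltr0n// mulrAC ler_pdivlMr ?ltr0n//.
  have [+ _] := lin _ _ (ltn0Sn n) k0; have [_] := lin _ _ k0 (ltn0Sn n).
  by rewrite (mulnC k) => h1 h2; lra.
exists (sup S) => n n0.
have n0' : 0 < n%:R :> R by rewrite ltr0n.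
have hS : has_sup S by split=> //; exists ((u n + c) / n%:R); exact: ubS.
have h1 : (u n - c) / n%:R <= sup S.
  by apply: sup_upper_bound => //; exists n.-1 => //; rewrite prednK.
have h2 : sup S <= (u n + c) / n%:R by apply: ge_sup => //; exact: ubS.
move: h1 h2; rewrite ler_pdivrMr// ler_pdivlMr// => h1 h2.
by rewrite ler_norml; apply/andP; split; lra.
Qed.

(** [expR y <= (1 - y)^-1], and [(1 - y) * (1 + y + 2 * y ^+ 2)] is
    [1 + y ^+ 2 * (1 - 2 * y)]. *)
Lemma expR_le_quad (R : realType) (y : R) : y <= 2^-1 ->
  expR y <= 1 + y + 2 * y ^+ 2.
Proof.
move=> y2; have h := expR_ge1Dx (- y).
have y1 : 0 < 1 - y by lra.
have : expR y <= (1 - y)^-1.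
  by rewrite -[expR y]invrK -expRN lef_pV2 ?posrE ?expR_gt0.
move=> /le_trans; apply.
by rewrite -div1r ler_pdivrMr//; nra.
Qed.

(** * Laws and independence of real random variables *)

Section laws.
Context d {Om : measurableType d} {R : realType} (P : probability Om R).
Implicit Types X Y Z : Om -> R.

Definition independent_rv X Y := forall A B : set R,
  measurable A -> measurable B ->
  P (X @^-1` A `&` Y @^-1` B) = (P (X @^-1` A) * P (Y @^-1` B))%E.

Definition same_law X Y := forall A : set R, measurable A ->
  P (X @^-1` A) = P (Y @^-1` A).

Local Open Scope ereal_scope.

Lemma same_law_integral X Y (f : R -> \bar R) :
  measurable_fun setT X -> measurable_fun setT Y -> same_law X Y ->
  measurable_fun setT f -> (forall y, 0 <= f y) ->
  \int[P]_x f (X x) = \int[P]_x f (Y x).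
Proof.
move=> mX mY XY mf f0.
pose X' : {mfun Om >-> R} := HB.pack X (isMeasurableFun.Build _ _ _ _ _ mX).
pose Y' : {mfun Om >-> R} := HB.pack Y (isMeasurableFun.Build _ _ _ _ _ mY).
have := ge0_integral_distribution (P := P) X' mf f0.
have := ge0_integral_distribution (P := P) Y' mf f0.
rewrite /comp /= => <- <-.
by apply: eq_measure_integral => A mA _; exact: XY.
Qed.

Lemma same_law_ae X Y (A : set R) :
  measurable_fun setT X -> measurable_fun setT Y -> same_law X Y ->
  measurable A -> (\forall x \ae P, A (Y x)) -> \forall x \ae P, A (X x).
Proof.
move=> mX mY XY mA AY.
have mXA : measurable (X @^-1` ~` A).
  by rewrite -[_ @^-1` _]setTI; apply: mX => //; exact: measurableC.
have mYA : measurable (Y @^-1` ~` A).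
  by rewrite -[_ @^-1` _]setTI; apply: mY => //; exact: measurableC.
have : P (X @^-1` ~` A) = 0.
  by rewrite XY; [exact/negligibleP|exact: measurableC].
by move/negligibleP => /(_ mXA).
Qed.

Lemma same_law_Rintegral X Y :
  measurable_fun setT X -> measurable_fun setT Y -> same_law X Y ->
  P.-integrable setT (EFin \o X) -> P.-integrable setT (EFin \o Y) ->
  (\int[P]_x X x)%R = (\int[P]_x Y x)%R.
Proof.
move=> mX mY XY iX iY.
pose X' : {mfun Om >-> R} := HB.pack X (isMeasurableFun.Build _ _ _ _ _ mX).
pose Y' : {mfun Om >-> R} := HB.pack Y (isMeasurableFun.Build _ _ _ _ _ mY).
have mE : measurable_fun setT (EFin : R -> \bar R) by exact: EFin_measurable.
congr fine; have := integral_distribution (P := P) (X := X') mE iX.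
have := integral_distribution (P := P) (X := Y') mE iY.
rewrite /comp /= => <- <-.
by apply: eq_measure_integral => A mA _; exact: XY.
Qed.

(** The joint law of [X] and [Y] is the product of their laws, since they agree
    on rectangles; Tonelli's theorem then factors the integral. *)
Lemma independent_integralM X Y (f g : R -> \bar R) :
  measurable_fun setT X -> measurable_fun setT Y -> independent_rv X Y ->
  measurable_fun setT f -> (forall y, 0 <= f y) ->
  measurable_fun setT g -> (forall y, 0 <= g y) ->
  \int[P]_x (f (X x) * g (Y x)) = \int[P]_x f (X x) * \int[P]_x g (Y x).
Proof.
move=> mX mY XY mf f0 mg g0.
pose X' : {mfun Om >-> R} := HB.pack X (isMeasurableFun.Build _ _ _ _ _ mX).
pose Y' : {mfun Om >-> R} := HB.pack Y (isMeasurableFun.Build _ _ _ _ _ mY).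
have mXY : measurable_fun setT (fun x => (X x, Y x)).
  by apply/measurable_fun_pairP; split.
pose XY' : {mfun Om >-> (R * R)%type} :=
  HB.pack (fun x => (X x, Y x)) (isMeasurableFun.Build _ _ _ _ _ mXY).
pose F (z : R * R) := f z.1 * g z.2.
have mF : measurable_fun setT F.
  apply: emeasurable_funM.
    by apply: measurableT_comp => //; exact: measurable_fst.
  by apply: measurableT_comp => //; exact: measurable_snd.
have F0 z : 0 <= F z by exact: mule_ge0.
have := ge0_integral_distribution (P := P) XY' mF F0.
rewrite /comp /= => <-.
have -> : \int[distribution P XY']_z F z =
    \int[distribution P X' \x distribution P Y']_z F z.
  apply: eq_measure_integral => A mA _; apply/esym.
  by apply: product_measure_unique => // B C mB mC; exact: XY.
rewrite fubini_tonelli1// /fubini_F /F /=.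
have := ge0_integral_distribution (P := P) X' mf f0.
have := ge0_integral_distribution (P := P) Y' mg g0.
rewrite /comp /= => hY hX.
under eq_integral.
  by move=> x _; rewrite ge0_integralZl// hY; over.
by rewrite ge0_integralZr// ?hX// integral_ge0.
Qed.

End laws.
(** * Exponential moments of quasi-additive processes *)

Section concentration.
Context d {Om : measurableType d} {R : realType} (P : probability Om R).
Implicit Types (X Y : Om -> R) (Z : nat -> Om -> R).

(** For [Z n := ln S_n(q)], [X] comes from mu_j and [Y] from mu^(j).  Only [Y]
    has the law of some [Z k]; [X] is compared with [Z j] itself. *)
Definition quasi_additive (c : R) Z := forall j k, (0 < j)%N -> (0 < k)%N ->
  exists X Y, [/\ measurable_fun setT X, measurable_fun setT Y,
    independent_rv P X Y, same_law P Y (Z k) &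
    \forall x \ae P, `|X x - Z j x| <= c /\
      `|Z (j + k)%N x - (X x + Y x)| <= c].

Definition mgf X (l : R) := (\int[P]_x (expR (l * X x))%:E)%E.

Lemma integral_cst_probability (r : \bar R) : (\int[P]_x (cst r x))%E = r.
Proof.
rewrite integral_cst//; transitivity (r * 1)%E; last by rewrite mule1.
by congr (_ * _)%E; exact: probability_setT.
Qed.

Lemma measurable_expRM X (l : R) : measurable_fun setT X ->
  measurable_fun setT (fun x => (expR (l * X x))%:E).
Proof.
move=> mX; apply/measurable_EFinP.
by apply: measurableT_comp => //; exact: measurable_funM.
Qed.

Lemma le_mgf X Y (l c : R) : measurable_fun setT X -> measurable_fun setT Y ->
  (\forall x \ae P, `|X x - Y x| <= c) ->
  (mgf X l <= (expR (`|l| * c))%:E * mgf Y l)%E.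
Proof.
move=> mX mY XY; rewrite /mgf -ge0_integralZl//; last exact: measurable_expRM.
apply: ae_ge0_le_integral => //.
- exact: measurable_expRM.
- by apply: emeasurable_funM => //; exact: measurable_expRM.
move: XY; apply: filterS => x XYx _.
rewrite -EFinM lee_fin -expRD ler_expR -lerBlDr -mulrBr.
by rewrite (le_trans (ler_norm _))// normrM ler_wpM2l.
Qed.

Lemma mgf_ge0 X l : (0 <= mgf X l)%E.
Proof. by apply: integral_ge0 => x _; rewrite lee_fin expR_ge0. Qed.

(** Independence enters only here.  Since the outcome is an inequality between
    numbers, it can be iterated, although [Y] itself is not decomposed into
    independent pieces on the probability space. *)
Lemma mgf_quasi_additive c Z (l : R) :
  (forall n, (0 < n)%N -> measurable_fun setT (Z n)) -> quasi_additive c Z ->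
  forall j k, (0 < j)%N -> (0 < k)%N ->
  (mgf (Z (j + k)%N) l <=
   (expR (`|l| * (c + c)))%:E * (mgf (Z j) l * mgf (Z k) l))%E.
Proof.
move=> mZ qZ j k j0 k0; have [X [Y [mX mY iXY YZ XZ]]] := qZ j k j0 k0.
have mXY : measurable_fun setT (fun x => X x + Y x) by exact: measurable_funD.
have jk0 : (0 < j + k)%N by rewrite addn_gt0 j0.
have h1 : (mgf (Z (j + k)%N) l <=
    (expR (`|l| * c))%:E * mgf (fun x => X x + Y x)%R l)%E.
  by apply: le_mgf; [exact: mZ|by []|move: XZ; apply: filterS => x []].
have h2 : (mgf X l <= (expR (`|l| * c))%:E * mgf (Z j) l)%E.
  by apply: le_mgf; [by []|exact: mZ|move: XZ; apply: filterS => x []].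
have h3 : mgf Y l = mgf (Z k) l.
  apply: (same_law_integral mY (mZ _ k0) YZ (f := fun y => (expR (l * y))%:E)).
    by apply/measurable_EFinP; apply: measurableT_comp => //;
      exact: measurable_funM.
  by move=> y; rewrite lee_fin expR_ge0.
have h4 : mgf (fun x => X x + Y x)%R l = (mgf X l * mgf Y l)%E.
  rewrite -(independent_integralM mX mY iXY (f := fun y => (expR (l * y))%:E)
     (g := fun y => (expR (l * y))%:E)).
  - by apply: eq_integral => x _; rewrite -EFinM -expRD mulrDr.
  - by apply/measurable_EFinP; apply: measurableT_comp => //;
      exact: measurable_funM.
  - by move=> y; rewrite lee_fin expR_ge0.
  - by apply/measurable_EFinP; apply: measurableT_comp => //;
      exact: measurable_funM.
  - by move=> y; rewrite lee_fin expR_ge0.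
apply: (le_trans h1); rewrite h4 h3 mulrDr expRD EFinM -muleA.
apply: lee_wpmul2l; first by rewrite lee_fin expR_ge0.
by rewrite muleA lee_wpmul2r// mgf_ge0.
Qed.

Lemma integrable_bounded_rv X (M : R) : measurable_fun setT X ->
  (\forall x \ae P, `|X x| <= M) -> P.-integrable setT (EFin \o X).
Proof.
move=> mX XM; apply/integrableP; split; first exact/measurable_EFinP.
apply: (@le_lt_trans _ _ (\int[P]_x (cst `|M|%:E x)))%E; last first.
  by rewrite integral_cst_probability ltry.
apply: ae_ge0_le_integral => //; last first.
- move: XM; apply: filterS => x h _.
  by rewrite lee_fin (le_trans h)// ler_norm.
- by move=> x _; rewrite lee_fin.
- rewrite (_ : (fun x => _) = EFin \o (fun x => `|X x|))//.
  by apply/measurable_EFinP; exact: measurableT_comp.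
Qed.

Lemma Rintegral_ae_dist X Y (M c : R) :
  measurable_fun setT X -> measurable_fun setT Y ->
  (\forall x \ae P, `|X x| <= M) -> (\forall x \ae P, `|X x - Y x| <= c) ->
  `|\int[P]_x X x - \int[P]_x Y x| <= c.
Proof.
move=> mX mY XM XYc.
have YM : \forall x \ae P, `|Y x| <= M + c.
  apply: filterS2 XM XYc => x h1 h2.
  have -> : Y x = X x - (X x - Y x) by lra.
  by rewrite (le_trans (ler_normB _ _))// lerD.
have iX := integrable_bounded_rv mX XM; have iY := integrable_bounded_rv mY YM.
rewrite -RintegralB//.
have mXY : measurable_fun setT (fun x => X x - Y x) by exact: measurable_funB.
have iXY := integrable_bounded_rv mXY XYc.
apply: (le_trans (le_normr_Rintegral _ _)) => //.
have -> : c = fine (\int[P]_x (cst c%:E x)).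
  by rewrite integral_cst_probability.
have c0 : 0 <= c.
  have [x hx] : exists x, `|X x - Y x| <= c.
    apply: contrapT => /forallNP h.
    have : P setT = 0%E.
      apply/negligibleP => //; move: XYc; apply: negligibleS => x _; exact: h.
    by rewrite probability_setT => /eqP; rewrite onee_eq0.
  exact: le_trans hx.
apply: fine_le.
- exact: integral_fune_fin_num (integrable_norm iXY).
- by rewrite integral_cst_probability.
apply: ae_ge0_le_integral => //.
- by apply/measurable_EFinP; exact: measurableT_comp.
- by move: XYc; apply: filterS => x h _; rewrite lee_fin.
Qed.

Lemma Rintegral_quasi_additive c (K : R) Z :
  (forall n, (0 < n)%N -> measurable_fun setT (Z n)) -> 
  (forall n, (0 < n)%N -> \forall x \ae P, `|Z n x| <= n%:R * K) ->
  quasi_additive c Z ->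
  forall j k, (0 < j)%N -> (0 < k)%N ->
  `|\int[P]_x Z (j + k)%N x - \int[P]_x Z j x - \int[P]_x Z k x| <= c + c.
Proof.
move=> mZ bZ qZ j k j0 k0; have [X [Y [mX mY iXY YZ XZ]]] := qZ j k j0 k0.
have jk0 : (0 < j + k)%N by rewrite addn_gt0 j0.
have mXY : measurable_fun setT (fun x => X x + Y x) by exact: measurable_funD.
have h1 : `|\int[P]_x Z (j + k)%N x - \int[P]_x (X x + Y x)| <= c.
  apply: (Rintegral_ae_dist (mZ _ jk0) mXY (bZ _ jk0)).
  by move: XZ; apply: filterS => x [].
have h2 : `|\int[P]_x Z j x - \int[P]_x X x| <= c.
  apply: (Rintegral_ae_dist (mZ _ j0) mX (bZ _ j0)).
  by move: XZ; apply: filterS => x []; rewrite distrC.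
have bY : \forall x \ae P, `|Y x| <= k%:R * K.
  apply: (same_law_ae mY (mZ _ k0) YZ (A := [set y | `|y| <= k%:R * K])).
    rewrite (_ : [set _ | _] = `[- (k%:R * K), k%:R * K]%classic)//.
    by apply/seteqP; split => y /=; rewrite in_itv/= ler_norml.
  exact: bZ.
have h3 : \int[P]_x Y x = \int[P]_x Z k x.
  apply: (same_law_Rintegral mY (mZ _ k0) YZ).
    exact: integrable_bounded_rv mY bY.
  exact: integrable_bounded_rv (mZ _ k0) (bZ _ k0).
have bX : \forall x \ae P, `|X x| <= j%:R * K + c.
  apply: filterS2 (bZ _ j0) XZ => x b [b' _].
  have -> : X x = Z j x + (X x - Z j x) by lra.
  by rewrite (le_trans (ler_normD _ _))// lerD.
rewrite RintegralD// in h1; [|exact: integrable_bounded_rv mX bX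
  |exact: integrable_bounded_rv mY bY].
rewrite h3 in h1.
have -> : \int[P]_x Z (j + k)%N x - \int[P]_x Z j x - \int[P]_x Z k x =
  (\int[P]_x Z (j + k)%N x - (\int[P]_x X x + \int[P]_x Z k x)) -
  (\int[P]_x Z j x - \int[P]_x X x) by lra.
by rewrite (le_trans (ler_normB _ _))// lerD.
Qed.

(** In the second order expansion of the exponential, the mean of [X] controls
    the first order term and the uniform bound the second order one. *)
Lemma le_mgf_centered X (M e l : R) : measurable_fun setT X ->
  (\forall x \ae P, `|X x| <= M) -> `|\int[P]_x X x| <= e ->
  `|l| * M <= 2^-1 ->
  (mgf X l <= (expR (`|l| * e + 2 * (`|l| * M) ^+ 2))%:E)%E.
Proof.
move=> mX XM Xe lM.
have lX : \forall x \ae P, `|l * X x| <= `|l| * M.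
  by move: XM; apply: filterS => x h; rewrite normrM ler_wpM2l.
have mlX : measurable_fun setT (fun x => l * X x) by exact: measurable_funM.
pose g x := 1 + l * X x; pose f x := g x + 2 * (l * X x) ^+ 2.
have mg : measurable_fun setT g by exact: measurable_funD.
have mf : measurable_fun setT f.
  by apply: measurable_funD => //; apply: measurable_funM => //;
    exact: measurable_funX.
have gM : \forall x \ae P, `|g x| <= 1 + `|l| * M.
  move: lX; apply: filterS => x h.
  by rewrite (le_trans (ler_normD _ _))// normr1 lerD2l.
have fg : \forall x \ae P, `|f x - g x| <= 2 * (`|l| * M) ^+ 2.
  move: lX; apply: filterS => x h.
  rewrite addrAC subrr add0r normrM normrX ger0_norm// ler_wpM2l//.
  by rewrite lerXn2r ?nnegrE// (le_trans _ h).
have fM : \forall x \ae P, `|f x| <= 1 + `|l| * M + 2 * (`|l| * M) ^+ 2.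
  apply: filterS2 gM fg => x h1 h2.
  have -> : f x = g x + (f x - g x) by lra.
  by rewrite (le_trans (ler_normD _ _))// lerD.
have iX := integrable_bounded_rv mX XM.
have ilX := integrable_bounded_rv mlX lX.
have ig := integrable_bounded_rv mg gM.
have if_ := integrable_bounded_rv mf fM.
have Ig : \int[P]_x g x = 1 + l * \int[P]_x X x.
  rewrite /g RintegralD//; last first.
    apply: (@integrable_bounded_rv (cst 1) 1) => //.
    by apply: aeW => x /=; rewrite normr1.
  rewrite RintegralZl//; congr (_ + _).
  by rewrite /Rintegral (integral_cst_probability 1%:E).
apply: (@le_trans _ _ (\int[P]_x (f x)%:E)%E).
  apply: ae_ge0_le_integral => //.
  - exact: measurable_expRM.
  - by move=> x _; rewrite lee_fin /f /g; nra.
  - exact/measurable_EFinP.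
  - move: lX; apply: filterS => x h _; rewrite lee_fin; apply: expR_le_quad.
    exact: le_trans (le_trans (ler_norm _) h) lM.
rewrite -(fineK (integrable_fin_num _ if_))// lee_fin.
rewrite (le_trans _ (expR_ge1Dx _))//.
have := Rintegral_ae_dist mf mg fM fg; rewrite Ig.
move=> /ler_normlP[_]; rewrite /Rintegral.
have : l * \int[P]_x X x <= `|l| * e.
  by rewrite (le_trans (ler_norm _))// normrM ler_wpM2l.
rewrite /Rintegral /=; lra.
Qed.

Lemma quasi_additive_center c Z (a : R) :
  quasi_additive c Z -> quasi_additive c (fun n x => Z n x - n%:R * a).
Proof.
move=> qZ j k j0 k0; have [X [Y [mX mY iXY YZ XZ]]] := qZ j k j0 k0.
have mshift (r : R) (A : set R) : measurable A ->
    measurable ((fun y => y - r) @^-1` A).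
  move=> mA; rewrite -[_ @^-1` _]setTI.
  by apply: (measurable_funB _ _ _ mA) => //; exact: measurable_id.
exists (fun x => X x - j%:R * a), (fun x => Y x - k%:R * a); split.
- exact: measurable_funB.
- exact: measurable_funB.
- by move=> A B mA mB; exact: (iXY _ _ (mshift _ _ mA) (mshift _ _ mB)).
- by move=> A mA; exact: (YZ _ (mshift _ _ mA)).
move: XZ; apply: filterS => x [h1 h2]; split.
  by rewrite (_ : _ - _ = X x - Z j x)//; lra.
by rewrite (_ : _ - (_ + _) = Z (j + k)%N x - (X x + Y x))// natrD; lra.
Qed.

(** [t] blocks of length [m] and a last one of length [r]; each of the [t] cuts
    costs a factor [expR (`|l| * (c + c))]. *)
Lemma mgf_blocks c Z (l B : R) (m : nat) :
  (forall n, (0 < n)%N -> measurable_fun setT (Z n)) -> quasi_additive c Z ->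
  (forall i, (0 < i <= m)%N -> (mgf (Z i) l <= (expR B)%:E)%E) ->
  forall t r, (0 < r <= m)%N ->
  (mgf (Z (t * m + r)%N) l <=
    (expR (t.+1%:R * B + t%:R * (`|l| * (c + c))))%:E)%E.
Proof.
move=> mZ qZ hB; elim=> [|t IH] r rm; first by rewrite mul1r mul0r addr0 hB.
have /andP[r0 rm'] := rm; have m0 := leq_trans r0 rm'.
rewrite mulSn -addnA.
apply: (le_trans (mgf_quasi_additive l mZ qZ m0 _)).
  by rewrite (leq_trans r0)// leq_addl.
apply: (@le_trans _ _ ((expR (`|l| * (c + c)))%:E * ((expR B)%:E *
    (expR (t.+1%:R * B + t%:R * (`|l| * (c + c))))%:E))%E).
  apply: lee_wpmul2l; first by rewrite lee_fin expR_ge0.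
  by apply: lee_pmul => //; [exact: mgf_ge0|exact: mgf_ge0|
    apply: hB; rewrite m0 leqnn|exact: IH].
rewrite -!EFinM lee_fin -!expRD ler_expR -[t.+2%:R]natr1 -[t.+1%:R]natr1.
by rewrite !mulrDl !mul1r; lra.
Qed.

End concentration.

Lemma powR34 (R : realType) (n : nat) : (0 < n)%N ->
  let s := Num.sqrt n%:R : R in let rho := n%:R `^ (3 / 4) : R in
  [/\ 1 <= s, s ^+ 2 = n%:R, s <= rho & rho ^+ 2 = n%:R * s].
Proof.
move=> n0 s rho; have n1 : 1 <= n%:R :> R by rewrite ler1n.
split.
- by rewrite -sqrtr1 ler_sqrt// (lt_le_trans _ n1).
- by rewrite sqr_sqrtr.
- by rewrite /s /rho -powR12_sqrt// ler_powR//; lra.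
- rewrite /rho -powR_mulrn ?powR_ge0// -powRrM.
  rewrite (_ : 3 / 4 * 2 = 1 + 2^-1); last by lra.
  rewrite powRD; last by apply/implyP => _; rewrite pnatr_eq0 -lt0n.
  by rewrite powRr1// powR12_sqrt.
Qed.

(** * Deviations of quasi-additive processes *)

Section deviation.
Context d {Om : measurableType d} {R : realType} (P : probability Om R).
Implicit Types (X Y : Om -> R) (Z : nat -> Om -> R).

(** With about [sqrt n] blocks of length about [sqrt n] and [l] of order
    [n^(-3/4)], the cuts and the means contribute at most
    [sqrt n * l = n^(-1/4)] to the logarithm, and the second order terms
    [sqrt n * (l * sqrt n) ^ 2 = 1]. *)
Lemma mgf_block_bound c Z (M e l : R) (n : nat) :
  (forall n, (0 < n)%N -> measurable_fun setT (Z n)) ->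
  quasi_additive P c Z -> 1 <= M -> 0 <= c -> 0 <= e ->
  (forall n, (0 < n)%N -> \forall x \ae P, `|Z n x| <= n%:R * M) ->
  (forall n, (0 < n)%N -> `|\int[P]_x Z n x| <= e) ->
  (0 < n)%N -> `|l| = (2 * M * n%:R `^ (3 / 4))^-1 ->
  (mgf P (Z n) l <= (expR (3 * (e + (c + c) + 1)))%:E)%E.
Proof.
move=> mZ qZ M1 c0 e0 bZ eZ n0 lE.
have [s1 s2 srho rho2] := powR34 R n0.
set s := Num.sqrt _ in s1 s2 srho rho2; set rho := _ `^ _ in srho rho2 lE.
have rho0 : 0 < rho by lra.
(* [m] is the length of the blocks, and [t] below their number. *)
pose m := Num.truncn s.
have m0 : (0 < m)%N by rewrite truncn_gt0.
have /andP[ms sm] : m%:R <= s < m.+1%:R by apply: truncn_itv; lra.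
have m1 : 1 <= m%:R :> R by rewrite ler1n.
have l2s : `|l| * (2 * s) <= 1.
  rewrite lE mulrC ler_pdivrMr; last by nra.
  by nra.
have l0 : 0 <= `|l| by [].
have lMm : `|l| * (M * m%:R) * (2 * rho) = m%:R.
  rewrite lE; field.
  by apply/andP; split; apply: lt0r_neq0 => //; lra.
have lMm2 : `|l| * (M * m%:R) <= 2^-1.
  by rewrite -(ler_pM2r (x := 2 * rho)); [rewrite lMm; lra|lra].
have q2 : (`|l| * (M * m%:R)) ^+ 2 * (4 * s) <= 1.
  have : (`|l| * (M * m%:R) * (2 * rho)) ^+ 2 <= s ^+ 2.
    by rewrite lMm lerXn2r ?nnegrE//; lra.
  rewrite exprMn [(2 * rho) ^+ 2]exprMn rho2 -s2.
  set q := (_ * _) ^+ 2 => qs.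
  have : q * (4 * s) * s ^+ 2 <= 1 * s ^+ 2 by nra.
  by rewrite ler_pM2r// exprn_gt0//; lra.
pose B := `|l| * e + 2 * (`|l| * (M * m%:R)) ^+ 2.
have hB i : (0 < i <= m)%N -> (mgf P (Z i) l <= (expR B)%:E)%E.
  move=> /andP[i0 im]; apply: le_mgf_centered.
  - exact: mZ.
  - move: (bZ _ i0); apply: filterS => x /le_trans; apply.
    by rewrite mulrC ler_wpM2l ?ler_nat//; lra.
  - exact: eZ.
  - exact: lMm2.
pose t := (n.-1 %/ m)%N; pose r := (n.-1 %% m).+1.
have nE : n = (t * m + r)%N by rewrite /r addnS -divn_eq prednK.
have rm : (0 < r <= m)%N by rewrite /= ltn_mod.
rewrite nE; apply: (le_trans (mgf_blocks mZ qZ hB t rm)).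
rewrite lee_fin ler_expR.
have tm : t%:R * m%:R <= s ^+ 2.
  by rewrite s2 -natrM ler_nat [leqRHS]nE leq_addr.
have t2s : t%:R <= 2 * s.
  have t0 : 0 <= t%:R :> R by [].
  have sm2 : s <= 2 * m%:R by move: sm; rewrite -natr1; lra.
  have : t%:R * s <= (2 * s) * s by nra.
  by rewrite ler_pM2r//; lra.
have Bs : B * (2 * s) <= e + 1.
  rewrite /B; move: q2 l2s; set q := (_ ^+ 2) => q2 l2s.
  have : `|l| * (2 * s) * e <= 1 * e by rewrite ler_wpM2r.
  lra.
have B0 : 0 <= B by rewrite /B addr_ge0 ?mulr_ge0 ?exprn_ge0//; lra.
have ls : `|l| * (c + c) * (2 * s) <= c + c.
  have : `|l| * (2 * s) * (c + c) <= 1 * (c + c) by rewrite ler_wpM2r//; lra.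
  lra.
have lc0 : 0 <= `|l| * (c + c) by rewrite mulr_ge0//; lra.
have : t.+1%:R <= 3 * s by rewrite -natr1; lra.
have : t%:R <= 3 * s by lra.
move: (`|l| * (c + c)) lc0 ls => L L0 Ls h1 h2.
have : t.+1%:R * B <= 3 * s * B by rewrite ler_wpM2r.
have : t%:R * L <= 3 * s * L by rewrite ler_wpM2r.
lra.
Qed.

Lemma mgf_markov X (l x0 : R) : measurable_fun setT X ->
  (P [set x | (x0 <= l * X x)%R] <= (expR (- x0))%:E * mgf P X l)%E.
Proof.
move=> mX; have mlX : measurable_fun setT (fun x => l * X x).
  exact: measurable_funM.
pose X' : {mfun Om >-> R} :=
  HB.pack (fun x => l * X x) (isMeasurableFun.Build _ _ _ _ _ mlX).
have := chernoff (P := P) X' x0 ltr01; rewrite mul1r muleC => /le_trans; apply.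
apply: lee_wpmul2l; first by rewrite lee_fin expR_ge0.
rewrite /mmt_gen_fun unlock /mgf le_eqVlt; apply/orP; left; apply/eqP.
by apply: eq_integral => x _ /=; rewrite mulr1.
Qed.

(** Markov's inequality for [expR (l * Y)], where [Y] is [Z n - n * a] and
    [l = (2 * M * n^(3/4))^-1] with [M = 2 * M0 + 2 * c + 1] a bound for
    [`|Y| / n]: the threshold is [3 * ln n / l], which produces the [n^(-3)]. *)
Theorem quasi_additive_deviation c Z (M0 : R) :
  (forall n, (0 < n)%N -> measurable_fun setT (Z n)) ->
  quasi_additive P c Z -> 0 <= M0 -> 0 <= c ->
  (forall n, (0 < n)%N -> \forall x \ae P, `|Z n x| <= n%:R * M0) ->
  exists a : R,
   (forall n, (0 < n)%N -> `|\int[P]_x Z n x - n%:R * a| <= c + c) /\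
   forall n, (0 < n)%N ->
    (P [set x | (6 * (2 * M0 + 2 * c + 1) * (n%:R `^ (3 / 4) * ln n%:R)
        <= `|Z n x - n%:R * a|)%R]
      <= (2 * expR (3 * (4 * c + 1)) / n%:R ^+ 3)%:E)%E.
Proof.
move=> mZ qZ M00 c0 bZ.
have [a aP] := quasi_additive_limit (Rintegral_quasi_additive mZ bZ qZ).
exists a; split => // n n0.
pose M := 2 * M0 + 2 * c + 1; rewrite -/M.
have M1 : 1 <= M by rewrite /M; lra.
pose Y n x := Z n x - n%:R * a.
have mY k : (0 < k)%N -> measurable_fun setT (Y k).
  by move=> k0; apply: measurable_funB => //; exact: mZ.
have qY : quasi_additive P c Y by exact: quasi_additive_center.
have EY k : (0 < k)%N -> `|\int[P]_x Y k x| <= c + c.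
  move=> k0; rewrite /Y RintegralB//.
  - rewrite [X in _ - X](_ : _ = k%:R * a); first exact: aP.
    by rewrite /Rintegral (integral_cst_probability _ (k%:R * a)%:E).
  - exact: integrable_bounded_rv (mZ _ k0) (bZ _ k0).
  - apply: (@integrable_bounded_rv _ _ _ _ (cst (k%:R * a)) `|k%:R * a|) => //.
    exact: aeW.
have a0 : `|a| <= M0 + 2 * c.
  have h1 := EY 1%N isT.
  have h2 : `|\int[P]_x Z 1%N x| <= M0.
    have := Rintegral_ae_dist (P := P) (X := Z 1%N) (Y := cst 0) (c := M0)
      (mZ _ (ltn0Sn 0)) (measurable_cst _) (bZ _ (ltn0Sn 0)).
    rewrite /Rintegral (integral_cst_probability _ 0%E) subr0; apply.
    by move: (bZ 1%N isT); apply: filterS => x /=; rewrite subr0 mul1r.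
  have := aP 1%N isT; rewrite mul1r distrC => h3.
  have -> : a = (a - \int[P]_x Z 1%N x) + \int[P]_x Z 1%N x by lra.
  by rewrite (le_trans (ler_normD _ _))//; lra.
have bY k : (0 < k)%N -> \forall x \ae P, `|Y k x| <= k%:R * M.
  move=> k0; move: (bZ _ k0); apply: filterS => x h.
  rewrite (le_trans (ler_normB _ _))// normrM normr_nat.
  have : k%:R * `|a| <= k%:R * (M0 + 2 * c) by rewrite ler_wpM2l.
  have : 1 <= k%:R :> R by rewrite ler1n.
  by rewrite /M; lra.
have [s1 s2 srho rho2] := powR34 R n0.
set rho := _ `^ _ in srho rho2 *.
have rho0 : 0 < rho by lra.
have n1 : 1 <= n%:R :> R by rewrite ler1n.
pose l := (2 * M * rho)^-1.
have l0 : 0 < l by rewrite invr_gt0 !mulr_gt0//; lra.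
have cc0 : 0 <= c + c by lra.
have H e : `|e| = l ->
    (P [set x | (3 * ln n%:R <= e * Y n x)%R] <=
      (expR (3 * (4 * c + 1)) / n%:R ^+ 3)%:E)%E.
  move=> el; apply: (le_trans (mgf_markov _ _ (mY _ n0))).
  apply: (@le_trans _ _ ((expR (- (3 * ln n%:R)))%:E *
      (expR (3 * (c + c + (c + c) + 1)))%:E)%E).
    apply: lee_wpmul2l; first by rewrite lee_fin expR_ge0.
    exact: (mgf_block_bound mY qY M1 c0 cc0 bY EY n0).
  have -> : expR (- (3 * ln n%:R)) = (n%:R ^+ 3)^-1 :> R.
    by rewrite expRN [3 * _]mulrC expRM lnK ?posrE ?ltr0n// powR_mulrn.
  rewrite -EFinM lee_fin mulrC ler_pM2r ?invr_gt0 ?exprn_gt0 ?ltr0n//.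
  by rewrite ler_expR; lra.
have mE e : measurable [set x | (3 * ln n%:R <= e * Y n x)%R].
  rewrite -[X in measurable X]setTI.
  rewrite (_ : [set _ | _] =
      (fun x => e * Y n x) @^-1` `[(3 * ln n%:R)%R, +oo[%classic).
    by apply: (measurable_funM _ (mY _ n0)) => //; exact: measurable_cst.
  by apply/seteqP; split => x /=; rewrite in_itv/= andbT.
apply: (@le_trans _ _ (P ([set x | (3 * ln n%:R <= l * Y n x)%R] `|`
   [set x | (3 * ln n%:R <= - l * Y n x)%R]))).
  have mn : measurable_fun setT (fun x => `|Y n x|).
    by apply: measurableT_comp => //; exact: mY.
  apply: le_measure; rewrite ?inE.
  - rewrite -[X in measurable X]setTI.
    rewrite (_ : [set _ | _] = (fun x => `|Y n x|) @^-1`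
      `[6 * M * (rho * ln n%:R), +oo[%classic); first exact: mn.
    by apply/seteqP; split => x /=; rewrite in_itv/= andbT.
  - exact: measurableU.
  move=> x /=; rewrite -/(Y n x) => h.
  have : 3 * ln n%:R <= l * `|Y n x|.
    have lM : l * (2 * M * rho) = 1.
      by rewrite mulVf// lt0r_neq0// !mulr_gt0//; lra.
    have := ler_wpM2l (ltW l0) h.
    have -> : l * (6 * M * (rho * ln n%:R)) = 3 * ln n%:R; last by [].
    transitivity (l * (2 * M * rho) * (3 * ln n%:R)); last by rewrite lM mul1r.
    by clearbody l M; ring.
  by case: (ger0P (Y n x)) => _ hh; [left|right] => //; rewrite mulNr -mulrN.
apply: (le_trans (measureU2 _ _ _)); [exact: mE..|].
apply: (@le_trans _ _ ((expR (3 * (4 * c + 1)) / n%:R ^+ 3)%:E +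
   (expR (3 * (4 * c + 1)) / n%:R ^+ 3)%:E)%E).
  by apply: leeD; apply: H; rewrite ?normrN gtr0_norm.
by rewrite -EFinD lee_fin; lra.
Qed.

End deviation.

(** * The Borel-Cantelli lemma *)

Section borel_cantelli.
Context d {T : measurableType d} {R : realType}.
Variable P : {finite_measure set T -> \bar R}.

Lemma borel_cantelli_dominated (B : nat -> set T) (f : nat -> R) (n0 : nat) :
  (forall n, measurable (B n)) -> (forall n, (1 <= n)%N -> 0 <= f n) ->
  cvgn (fun n => \sum_(1 <= k < n) f k) ->
  (forall n, (n0 <= n)%N -> (P (B n) <= (f n)%:E)%E) ->
  \forall x \ae P, exists p, (1 <= p)%N /\ forall n, (p <= n)%N -> ~ B n x.
Proof.
move=> mB f0 fcvg PB; pose n1 := maxn n0 1.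
have f'0 k : 0 <= f (k + n1)%N 
  by apply: f0; exact: leq_trans (leq_maxr n0 1) (leq_addl _ _).
set S := limn (fun n => \sum_(1 <= k < n) f k).
have fS n : \sum_(k < n) f (k + n1)%N <= S.
  have nd : nondecreasing_seq (fun n => \sum_(1 <= k < n) f k).
    apply/nondecreasing_seqP => -[|[|k]]; [by rewrite !big_geq|by rewrite big_nat1 big_geq// f0|].
    by rewrite [leRHS]big_nat_recr//= lerDl f0.
  apply: le_trans (nondecreasing_cvgn_le nd fcvg (n + n1)%N).
  have n11 : (1 <= n1)%N by rewrite leq_maxr.
  have -> : \sum_(k < n) f (k + n1)%N = \sum_(n1 <= k < n + n1) f k.
    by rewrite -[X in \sum_(X <= _ < _) _]add0n big_addn addnK big_mkord.
  rewrite [leRHS](big_cat_nat _ (n := n1))//= ?leq_addl// lerDr.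
  by rewrite big_nat_cond sumr_ge0// => k /andP[/andP[/f0]].
have mB' n : measurable (B (n + n1)%N) by exact: mB.
have : (\sum_(n <oo) P (B (n + n1)%N) < +oo)%E.
  apply: (@le_lt_trans _ _ S%:E); last exact: ltry.
  apply: lime_le; first by apply: is_cvg_nneseries.
  apply: nearW => n; rewrite big_mkord.
  apply: (@le_trans _ _ (\sum_(k < n) (f (k + n1)%N)%:E)%E).
    by apply: lee_sum => k _; apply: PB; exact: leq_trans (leq_maxl n0 1) (leq_addl _ _).
  by rewrite sumEFin lee_fin.
move=> /(lim_sup_set_cvg0 mB') L0.
have mL : measurable (lim_sup_set (fun n => B (n + n1)%N)).
  by apply: bigcap_measurable => // k _; exact: bigcup_measurable.
move/negligibleP : L0 => /(_ mL); apply: negligibleS => x /= /forallNP h k _ /=.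
have : ~ forall n, (k + n1 <= n)%N -> ~ B n x.
  move=> hh; apply: (h (k + n1)%N); split => //.
  exact: leq_trans (leq_maxr n0 1) (leq_addl _ _).
move=> /existsNP[n] /not_implyP[kn] /contrapT Bn.
exists (n - n1)%N; first by rewrite /= leq_subRL ?(leq_trans (leq_addl _ _) kn) // addnC.
by rewrite subnK// (leq_trans (leq_addl _ _) kn).
Qed.

End borel_cantelli.

(** The sum up to [n] is at most [C * (2 - n^-1)], by telescoping. *)
Lemma cvg_sum_inv_square (R : realType) (C : R) : 0 <= C ->
  cvgn (fun n => \sum_(1 <= k < n) C / k%:R ^+ 2).
Proof.
move=> C0; apply: nondecreasing_is_cvgn.
  apply/nondecreasing_seqP => -[|[|k]]; [by rewrite !big_geq|
    by rewrite big_nat1 big_geq// divr_ge0// exprn_ge0|].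
  by rewrite [leRHS]big_nat_recr//= lerDl divr_ge0// exprn_ge0.
have B n : \sum_(1 <= k < n.+2) C / k%:R ^+ 2 <= C * (2 - (n.+1%:R)^-1).
  elim: n => [|n IH]; first by rewrite big_nat1 expr1n invr1; lra.
  rewrite big_nat_recr//=.
  apply: (le_trans (lerD IH (lexx _))); rewrite -mulrDr ler_wpM2l//.
  have n0 : 0 < n.+1%:R :> R by rewrite ltr0n.
  rewrite -[n.+2%:R]natr1; set x := n.+1%:R in n0 *.
  have -> : 2 - x^-1 + (x + 1) ^- 2 = 2 - (x + 1)^-1 - (x * (x + 1) ^+ 2)^-1.
    by field; apply/andP; split; apply: lt0r_neq0; lra.
  by rewrite gerBl invr_ge0 mulr_ge0 ?exprn_ge0//; lra.
exists (C * 2) => _ [[|[|n]] _ <-]; [by rewrite big_geq// mulr_ge0..|].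
by apply: (le_trans (B n)); rewrite ler_wpM2l// lerBlDr lerDl invr_ge0.
Qed.

(** * Deviations uniform in a parameter *)

Lemma grid_approx (R : realType) (Q n : nat) (q : R) : (0 < n)%N ->
  `|q| <= Q%:R -> exists2 i, (i < (2 * n * Q).+1)%N &
    `|q - (i%:R / n%:R - Q%:R)| <= n%:R^-1 /\ `|i%:R / n%:R - Q%:R| <= Q%:R :> R.
Proof.
move=> n0 /ler_normlP[q1 q2]; have n0' : 0 < n%:R :> R by rewrite ltr0n.
have y0 : 0 <= n%:R * (q + Q%:R) by rewrite mulr_ge0//; lra.
exists (Num.truncn (n%:R * (q + Q%:R))).
  rewrite ltnS -(ler_nat R); have := truncn_le (n%:R * (q + Q%:R)).
  rewrite y0 => /le_trans; apply; rewrite !natrM mulrAC [leRHS]mulrC ler_wpM2l//.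
  lra.
have /andP[h1 h2] := truncn_itv y0; set t := Num.truncn _ in h1 h2 *.
have t0 : 0 <= t%:R / n%:R :> R by rewrite divr_ge0.
have h3 : t%:R / n%:R <= q + Q%:R by rewrite ler_pdivrMr// mulrC.
have h4 : q + Q%:R <= t%:R / n%:R + n%:R^-1.
  have -> : t%:R / n%:R + n%:R^-1 = t.+1%:R / n%:R :> R.
    by rewrite -natr1 mulrDl mul1r.
  by rewrite ler_pdivlMr// mulrC ltW.
split; rewrite ler_norml; apply/andP; split; lra.
Qed.

Section uniform_deviation.
Context d {Om : measurableType d} {R : realType} (P : probability Om R).
Variables (Z : R -> nat -> Om -> R) (Q : nat) (c M0 L : R).
Let D := 6 * (2 * M0 + 2 * c + 1).
Let rate (n : nat) : R := n%:R `^ (3 / 4) * ln n%:R.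

(** A union bound over the points [i / n - Q] turns [n^(-3)] into [n^(-2)],
    which is summable.  From a point of this grid to a parameter at distance
    [1 / n], both [Z q n] and [n * a q] change by at most [L]; this gives the
    term [2 * L], as [rate n] is eventually at least [1]. *)
Theorem uniform_deviation :
  (forall q n, (0 < n)%N -> measurable_fun setT (Z q n)) ->
  0 <= M0 -> 0 <= c -> 0 <= L ->
  (forall q, `|q| <= Q%:R -> quasi_additive P c (Z q)) ->
  (forall q, `|q| <= Q%:R ->
    forall n, (0 < n)%N -> \forall x \ae P, `|Z q n x| <= n%:R * M0) ->
  (\forall x \ae P, forall n q q', (0 < n)%N ->
    `|Z q n x - Z q' n x| <= n%:R * (L * `|q - q'|)) ->
  exists a : R -> R, \forall x \ae P, exists p, (1 <= p)%N /\
    forall n, (p <= n)%N -> forall q, `|q| <= Q%:R ->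
      `|Z q n x - n%:R * a q| <= (D + 2 * L) * rate n.
Proof.
move=> mZ M00 c0 L0 qZ bZ lZ.
have /choice[a aP] (q : R) : exists a : R, `|q| <= Q%:R ->
   (forall n, (0 < n)%N -> `|\int[P]_x Z q n x - n%:R * a| <= c + c) /\
   forall n, (0 < n)%N ->
    (P [set x | (D * rate n <= `|Z q n x - n%:R * a|)%R]
      <= (2 * expR (3 * (4 * c + 1)) / n%:R ^+ 3)%:E)%E.
  have [qQ|_] := lerP `|q| Q%:R; last by exists 0.
  have [a ha] := quasi_additive_deviation (mZ q) (qZ q qQ) M00 c0 (bZ q qQ).
  by exists a.
(* The means of [Z q n / n] are Lipschitz in [q], hence so is their limit. *)
have aL q q' : `|q| <= Q%:R -> `|q'| <= Q%:R -> `|a q - a q'| <= L * `|q - q'|.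
  move=> hq hq'; apply/ler_addgt0Pl => e e0.
  pose n := (Num.truncn (4 * c / e)).+1.
  have n0 : 0 < n%:R :> R by rewrite ltr0n.
  have ne : 4 * c <= n%:R * e.
    rewrite -ler_pdivrMr// ltW//.
    have y0 : 0 <= 4 * c / e by rewrite divr_ge0// ?mulr_ge0// ltW.
    by have /andP[] := truncn_itv y0.
  have h1 := (aP q hq).1 n isT; have h2 := (aP q' hq').1 n isT.
  have h3 : `|\int[P]_x Z q n x - \int[P]_x Z q' n x| <=
      n%:R * (L * `|q - q'|).
    apply: (Rintegral_ae_dist (mZ q n isT) (mZ q' n isT) (bZ q hq n isT)).
    by move: lZ; apply: filterS => x /(_ n q q' isT).
  rewrite -(ler_pM2l n0) -[leLHS](ger0_norm (mulr_ge0 (ltW n0) (normr_ge0 _))).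
  rewrite normrM normr_id -normrM mulrBr.
  move: h1 h2 h3.
  set I := Rintegral _ _ _; set I' := Rintegral _ _ _ => h1 h2 h3.
  have -> : n%:R * a q - n%:R * a q' =
    - (I - n%:R * a q) + ((I' - n%:R * a q') + (I - I')) by lra.
  rewrite (le_trans (ler_normD _ _))// (le_trans (lerD (lexx _) (ler_normD _ _)))//.
  by rewrite normrN mulrDr; lra.
exists a.
pose g (n i : nat) : R := i%:R / n%:R - Q%:R.
pose bad1 n i := [set x | (`|g n i| <= Q%:R) &&
  (D * rate n <= `|Z (g n i) n x - n%:R * a (g n i)|)].
pose bad n := if n is 0%N then set0 else
  \big[setU/set0]_(i < (2 * n * Q).+1) bad1 n i.
have mbad1 n i : (0 < n)%N -> measurable (bad1 n i).
  move=> n0; rewrite /bad1; case: (`|g n i| <= Q%:R) => /=; last first.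
    by rewrite (_ : [set _ | _] = set0)//; apply/seteqP; split.
  have mn : measurable_fun setT (fun x => `|Z (g n i) n x - n%:R * a (g n i)|).
    by apply: measurableT_comp => //; apply: measurable_funB => //; exact: mZ.
  rewrite -[X in measurable X]setTI.
  rewrite (_ : [set _ | _] = (fun x => `|Z (g n i) n x - n%:R * a (g n i)|) @^-1`
      `[D * rate n, +oo[%classic); first exact: mn.
  by apply/seteqP; split => x /=; rewrite in_itv/= andbT.
have mbad n : measurable (bad n).
  by case: n => //= n; apply: bigsetU_measurable => i _; exact: mbad1.
pose C := 2 * expR (3 * (4 * c + 1)).
have C0 : 0 <= C by rewrite mulr_ge0// expR_ge0.
have Pbad n : (1 <= n)%N -> (P (bad n) <= ((2 * Q%:R + 1) * C / n%:R ^+ 2)%:E)%E.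
  move=> n1; have n0 : 0 < n%:R :> R by rewrite ltr0n.
  have -> : bad n = \big[setU/set0]_(i < (2 * n * Q).+1) bad1 n i by case: n n1 {n0}.
  apply: (le_trans (le_mu_bigsetU _ _)) => [i _|]; first exact: mbad1.
  apply: (@le_trans _ _ (\sum_(i < (2 * n * Q).+1) (C / n%:R ^+ 3)%:E)%E).
    apply: lee_sum => i _; rewrite /bad1.
    have [gQ|_] /= := lerP `|g n i| Q%:R; first exact: (aP _ gQ).2.
    rewrite (_ : [set _ | _] = set0) ?measure0; last by apply/seteqP; split.
    by rewrite lee_fin divr_ge0// exprn_ge0.
  rewrite sumEFin lee_fin sumr_const card_ord -[leLHS]mulr_natr -[_.+1%:R]natr1 !natrM.
  rewrite [leRHS](_ : _ = C / n%:R ^+ 3 * ((2 * Q%:R + 1) * n%:R)); last first.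
    by field; rewrite lt0r_neq0.
  rewrite ler_wpM2l ?divr_ge0 ?exprn_ge0//.
  have : 1 <= n%:R :> R by rewrite ler1n.
  lra.
have Q0 : 0 <= (2 * Q%:R + 1) * C by rewrite mulr_ge0// addr_ge0// mulr_ge0.
have := borel_cantelli_dominated (P := P) mbad _ (cvg_sum_inv_square Q0) Pbad.
move=> /(_ (fun n _ => divr_ge0 Q0 (exprn_ge0 _ (ler0n _ _)))) BC.
apply: filterS2 lZ BC => x lx [p [p1 hp]].
(* Beyond [expR 1], the logarithm is at least [1], hence so is [rate]. *)
pose n0 := (maxn p (Num.truncn (expR 1 : R)).+1).
exists n0; split; first by rewrite leq_max p1.
move=> n; rewrite geq_max => /andP[pn en] q qQ.
have n1 : (0 < n)%N by exact: leq_trans pn.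
have ln1 : 1 <= ln n%:R :> R.
  have h : expR 1 <= n%:R :> R.
    have /andP[_ /ltW/le_trans] := truncn_itv (expR_ge0 (1 : R)); apply.
    by rewrite ler_nat.
  by rewrite -ler_expR lnK// posrE ltr0n.
have [s1 s2 srho rho2] := powR34 R n1.
have rate1 : 1 <= rate n by rewrite /rate; nra.
have [i i_lt [qi gQ]] := grid_approx n1 qQ.
rewrite -/(g n i) in qi gQ.
have : ~ bad1 n i x.
  move=> b; apply: (hp n pn).
  have -> : bad n = \big[setU/set0]_(i < (2 * n * Q).+1) bad1 n i.
    by case: n n1 {pn en ln1 s1 s2 srho rho2 rate1 i_lt qi gQ b}.
  by rewrite -bigcup_mkord; exists i.
rewrite /bad1 /= gQ /= => /negP; rewrite -ltNge => h1.
have h2 := lx n q (g n i) n1; have h3 := aL q (g n i) qQ gQ.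
have n0' : 0 < n%:R :> R by rewrite ltr0n.
have h4 : n%:R * (L * `|q - g n i|) <= L.
  rewrite mulrCA -[leRHS]mulr1 ler_wpM2l//.
  by rewrite -(ler_pM2l n0') mulfV ?lt0r_neq0// in qi.
have h5 : `|n%:R * a q - n%:R * a (g n i)| <= L.
  rewrite -mulrBr normrM normr_nat; apply: le_trans h4.
  by rewrite ler_wpM2l.
have -> : Z q n x - n%:R * a q = (Z q n x - Z (g n i) n x) +
  ((Z (g n i) n x - n%:R * a (g n i)) - (n%:R * a q - n%:R * a (g n i))) by lra.
rewrite (le_trans (ler_normD _ _))// (le_trans (lerD (lexx _) (ler_normB _ _)))//.
have : L <= L * rate n by rewrite ler_peMr.
by move: h1 h2 h4 h5; lra.
Qed.

End uniform_deviation.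

(** * Words, their indices and their neighbours *)

Section words_lemmas.
Variables (b : nat) (hb : (1 < b)%N).

Lemma big_tuple_cat (V : nmodType) (j k : nat) (F : (j + k).-tuple 'I_b -> V) :
  \sum_(w : (j + k).-tuple 'I_b) F w =
  \sum_(v : j.-tuple 'I_b) \sum_(u : k.-tuple 'I_b) F (cat_tuple v u).
Proof.
rewrite pair_big /=.
pose h (p : j.-tuple 'I_b * k.-tuple 'I_b) := cat_tuple p.1 p.2.
have hinj : injective h.
  move=> [v u] [v' u'] /(congr1 val)/eqP; rewrite /= eqseq_cat ?size_tuple//.
  by move=> /andP[/eqP/val_inj -> /eqP/val_inj ->].
have hb' : bijective h.
  by apply: inj_card_bij => //; rewrite card_prod !card_tuple expnD.
by rewrite (reindex h); last exact: onW_bij.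
Qed.

Lemma word_index_cons (n : nat) (x : 'I_b) (u : n.-tuple 'I_b) :
  word_index (cons_tuple x u) = (x * b ^ n + word_index u)%N.
Proof.
rewrite /word_index big_ord_recl /= subn1 /=; congr (_ + _)%N.
by apply: eq_bigr => i _; rewrite tnthS.
Qed.

Lemma word_index_lt (n : nat) (u : n.-tuple 'I_b) : (word_index u < b ^ n)%N.
Proof.
elim: n u => [|n IH] u; first by rewrite /word_index big_ord0.
case/tupleP: u => x u; rewrite word_index_cons expnS.
have := IH u; have := ltn_ord x; move: (b ^ n)%N (word_index u) => B i xb iB.
have : (x.+1 * B <= b * B)%N by rewrite leq_mul2r xb orbT.
by rewrite mulSn; lia.
Qed.

Lemma word_index_cat (j k : nat) (v : j.-tuple 'I_b) (u : k.-tuple 'I_b) :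
  word_index (cat_tuple v u) = (word_index v * b ^ k + word_index u)%N.
Proof.
elim: j v => [|j IH] v.
  have -> : cat_tuple v u = u :> k.-tuple 'I_b.
    by apply: val_inj; rewrite tuple0.
  by rewrite {2}/word_index big_ord0 mul0n.
case/tupleP: v => x v.
have -> : cat_tuple (cons_tuple x v) u =
    cons_tuple x (cat_tuple v u) :> (j + k).+1.-tuple 'I_b by exact: val_inj.
by rewrite !word_index_cons IH expnD mulnDl addnA mulnA.
Qed.

Lemma word_index_inj (n : nat) : injective (@word_index b n).
Proof.
elim: n => [|n IH] u v; first by rewrite [u]tuple0 [v]tuple0.
case/tupleP: u => x u; case/tupleP: v => y v; rewrite !word_index_cons => e.
have bn0 : (0 < b ^ n)%N by rewrite expn_gt0 (ltnW hb).
have xy : x = y :> nat.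
  have := congr1 (divn^~ (b ^ n)%N) e.
  by rewrite /= !divnMDl// !divn_small ?word_index_lt// !addn0.
by move: e; rewrite xy => /addnI/IH ->; congr cons_tuple; exact: val_inj.
Qed.

(** If [v] and [v'] differ, the interval of length [b ^ k] of the indices of the
    words with prefix [v] does not contain the index of the other word, so that
    the index of the first word is within [N] of one of its ends. *)
Lemma far_prefix_tail (j k N : nat) (v v' : j.-tuple 'I_b) (u u' : k.-tuple 'I_b) :
  (word_dist (cat_tuple v' u') (cat_tuple v u) <= N)%N -> v' != v ->
  (word_index u < N)%N || (b ^ k <= word_index u + N)%N.
Proof.
rewrite /word_dist !word_index_cat => dN vv'.
have : word_index v' != word_index v by rewrite (inj_eq (@word_index_inj _)).
have := word_index_lt u; have := word_index_lt u'.
move: (word_index u) (word_index u') (word_index v) (word_index v') (b ^ k)%N dN.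
move=> i i' x y B dN i'B iB.
rewrite neq_ltn => /orP[xy|xy]; apply/orP; [left|right].
  have : (y.+1 * B <= x * B)%N by rewrite leq_mul2r xy orbT.
  by rewrite mulSn; lia.
have : (x.+1 * B <= y * B)%N by rewrite leq_mul2r xy orbT.
by rewrite mulSn; lia.
Qed.

Lemma card_extremal_tails (k N : nat) :
  (#|[pred u : k.-tuple 'I_b | (word_index u < N)%N
      || (b ^ k <= word_index u + N)%N]| <= 2 * N)%N.
Proof.
set A := [pred u | _]; rewrite cardE -(size_map (@word_index b k)).
have -> : (2 * N)%N = size (iota 0 N ++ iota (b ^ k - N)%N N).
  by rewrite size_cat !size_iota mul2n addnn.
apply: uniq_leq_size.
  by rewrite map_inj_uniq ?enum_uniq//; exact: word_index_inj.
move=> _ /mapP[u + ->]; rewrite mem_enum inE /= => uA.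
by rewrite mem_cat !mem_iota; have := word_index_lt u; lia.
Qed.

End words_lemmas.

(** * Measures of cylinders *)

Section cylinder_measure.
Variables (R : realType) (b : nat) (hb : (1 < b)%N).
Variable m : {measure set (symb hb) -> \bar R}.
Local Open Scope ereal_scope.

Lemma measure_head_word (n : nat) (Q : pred (n.-tuple 'I_b)) :
  m [set t | Q (head_word t n)] = \sum_(v : n.-tuple 'I_b | Q v) m (cyl v).
Proof.
have -> : [set t | Q (head_word t n)] =
    \bigcup_(v in [set` enum Q]) cyl (hb := hb) v.
  apply/seteqP; split => t /=.
    move=> Qt; exists (head_word t n); first by rewrite /= mem_enum.
    by rewrite cylE.
  by move=> [v /=]; rewrite mem_enum cylE => Qv /= ->.
rewrite measure_fin_bigcup//.
- by rewrite -fsbig_seq ?enum_uniq// big_enum.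
- by move=> v v' _ _ [t]; rewrite !cylE => -[/= <- <-].
- by move=> v _; exact: measurable_cyl.
Qed.

Lemma head_word_cat (j k : nat) (t : symb hb) :
  exists u : k.-tuple 'I_b, head_word t (j + k) = cat_tuple (head_word t j) u.
Proof.
exists [tuple t (j + i)%N | i < k]; apply: eq_from_tnth => i.
rewrite tnth_mktuple; case: (split_ordP i) => i' ->.
  by rewrite tnth_lshift tnth_mktuple.
by rewrite tnth_rshift tnth_mktuple.
Qed.

Lemma measure_cyl_cat (j k : nat) (v : j.-tuple 'I_b) :
  m (cyl v) = \sum_(u : k.-tuple 'I_b) m (cyl (cat_tuple v u)).
Proof.
have takeE (v' : j.-tuple 'I_b) (u : k.-tuple 'I_b) :
    take j (cat_tuple v' u) = v' by rewrite /= take_size_cat ?size_tuple.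
pose Q (w : (j + k).-tuple 'I_b) := take j w == v.
have QE (t : symb hb) : Q (head_word t (j + k)) = (head_word t j == v).
  by have [u ->] := head_word_cat j k t; rewrite /Q takeE val_eqE.
have -> : cyl v = [set t : symb hb | Q (head_word t (j + k))].
  rewrite cylE; apply/seteqP; split => t; first by rewrite /mkset QE => ->.
  by rewrite /mkset QE => /eqP.
rewrite measure_head_word (big_mkcond (fun w => Q w)) big_tuple_cat.
rewrite (bigD1 v)//= [X in _ + X]big1 ?adde0.
  by apply: eq_bigr => u _; rewrite /Q takeE eqxx.
move=> v' /negbTE vv'; apply: big1 => u _.
by rewrite /Q takeE val_eqE vv'.
Qed.

End cylinder_measure.

Lemma ln_comparable (R : realType) (C x y : R) : 0 < C -> 0 < x -> 0 < y ->
  C^-1 * y <= x <= C * y -> `|ln x - ln y| <= ln C.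
Proof.
move=> C0 x0 y0 /andP[h1 h2].
rewrite ler_norml lerBrDr lerBlDr -lnV// -!lnM ?posrE ?invr_gt0//.
by rewrite !ler_ln ?posrE ?mulr_gt0 ?invr_gt0// h1 h2.
Qed.

Lemma le_powR_comparable (R : realType) (C x y q : R) : 0 < C -> 0 < x -> 0 < y ->
  C^-1 * y <= x <= C * y ->
  (C `^ `|q|)^-1 * y `^ q <= x `^ q <= C `^ `|q| * y `^ q.
Proof.
move=> C0 x0 y0 xy; have {xy}xy := ln_comparable C0 x0 y0 xy.
have hq : `|q * ln x - q * ln y| <= `|q| * ln C.
  by rewrite -mulrBr normrM ler_wpM2l.
rewrite /powR !gt_eqF// -expRN -!expRD !ler_expR.
by move: hq; rewrite ler_norml => /andP[? ?]; apply/andP; split; lra.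
Qed.

(** * One realization of a quasi-Bernoulli measure *)

Section quasi_bernoulli_path.
Context {R : realType} (b : nat) (hb : (1 < b)%N).
Variable m : {measure set (symb hb) -> \bar R}.

Definition mass (w : seq 'I_b) : R := fine (m (cyl w)).

Lemma mass_sum_cat (j k : nat) (v : j.-tuple 'I_b) :
  (forall u : k.-tuple 'I_b, m (cyl (v ++ u)) \is a fin_num) ->
  mass v = \sum_(u : k.-tuple 'I_b) mass (v ++ u).
Proof. by move=> vf; rewrite /mass (measure_cyl_cat m k v) sum_fine. Qed.

(** What is used of a realization of [mu].  [path_split] does not mention mu_j,
    which is comparable to [m] on the words of length [j]; [g] is mu^(j). *)
Record quasi_bernoulli_path (C c : R) : Prop := {
  path_C1 : 1 <= C;
  path_c : 0 < c <= 1;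
  path_fin : forall n (w : n.-tuple 'I_b), m (cyl w) \is a fin_num;
  path_gt0 : forall n (w : n.-tuple 'I_b), 0 < mass w;
  path_letter : forall n (w : n.-tuple 'I_b) (r : 'I_b),
    c * mass w <= mass (w ++ [:: r]);
  path_split : forall j, (0 < j)%N -> exists g : seq 'I_b -> R,
    forall k (v : j.-tuple 'I_b) (u : k.-tuple 'I_b), (0 < k)%N ->
      0 < g u /\
      C^-1 * (mass v * g u) <= mass (v ++ u) <= C * (mass v * g u) }.

Variables (C c : R).
Context (path : quasi_bernoulli_path C c).

Let C0 : 0 < C. Proof. by rewrite (lt_le_trans _ (path_C1 path)). Qed.

Let mass_cat (j k : nat) (v : j.-tuple 'I_b) :
  mass v = \sum_(u : k.-tuple 'I_b) mass (v ++ u).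
Proof. by apply: mass_sum_cat => u; exact: path_fin path _ (cat_tuple v u). Qed.

Lemma mass_cat_le (j k : nat) (v : j.-tuple 'I_b) (u : k.-tuple 'I_b) :
  mass (v ++ u) <= mass v.
Proof.
rewrite (mass_cat k v) (bigD1 u)//= lerDl sumr_ge0// => u' _.
exact: ltW (path_gt0 path (cat_tuple v u')).
Qed.

Lemma tupleSr (k : nat) (u : k.+1.-tuple 'I_b) :
  exists (u' : k.-tuple 'I_b) (r : 'I_b), u = u' ++ [:: r] :> seq 'I_b.
Proof.
case: (lastP u) (size_tuple u) => // s r; rewrite size_rcons => -[sk].
have sk' : size s == k by apply/eqP.
by exists (Tuple sk'), r; rewrite cats1.
Qed.

Lemma mass_cat_ge (j k : nat) (v : j.-tuple 'I_b) (u : k.-tuple 'I_b) :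
  c ^+ k * mass v <= mass (v ++ u).
Proof.
elim: k u => [|k IH] u; first by rewrite tuple0 /= cats0 expr0 mul1r.
have [u' [r ->]] := tupleSr u; rewrite catA.
apply: le_trans (path_letter path (cat_tuple v u') r).
have /andP[c0 _] := path_c path.
by rewrite exprS -mulrA ler_pM2l ?IH.
Qed.

Lemma partition_sum_gt0 (q : R) (n : nat) : 0 < partition_sum m q n.
Proof.
have w0 : n.-tuple 'I_b := nseq_tuple n (Ordinal (ltnW hb)).
rewrite /partition_sum (bigD1 w0)//= ltr_wpDr//.
  by apply: sumr_ge0 => w _; exact: powR_ge0.
by rewrite powR_gt0//; exact: path_gt0 path _ w0.
Qed.

Definition ext_sum (q : R) (n k : nat) (w : n.-tuple 'I_b) : R :=
  \sum_(u : k.-tuple 'I_b) mass (w ++ u) `^ q.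

Lemma partition_sum_ext (q : R) (n k : nat) :
  partition_sum m q (n + k) = \sum_(w : n.-tuple 'I_b) ext_sum q k w.
Proof. by rewrite /partition_sum big_tuple_cat. Qed.

Lemma ext_sum_comparable (q : R) (n k : nat) : (0 < n)%N -> (0 < k)%N ->
  exists G : R, 0 < G /\ forall w : n.-tuple 'I_b,
    (C `^ `|q|)^-1 * (mass w `^ q * G) <= ext_sum q k w
      <= C `^ `|q| * (mass w `^ q * G).
Proof.
move=> n0 k0; have [g hg] := path_split path n0.
have w0 : n.-tuple 'I_b := nseq_tuple n (Ordinal (ltnW hb)).
have u0 : k.-tuple 'I_b := nseq_tuple k (Ordinal (ltnW hb)).
exists (\sum_(u : k.-tuple 'I_b) g u `^ q); split.
  rewrite (bigD1 u0)//= ltr_wpDr//.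
    by apply: sumr_ge0 => w _; exact: powR_ge0.
  by rewrite powR_gt0//; exact: (hg _ w0 u0 k0).1.
move=> w; rewrite /ext_sum !mulr_sumr.
have h (u : k.-tuple 'I_b) :
    (C `^ `|q|)^-1 * (mass w `^ q * g u `^ q) <= mass (w ++ u) `^ q
      <= C `^ `|q| * (mass w `^ q * g u `^ q).
  have [g0 gg] := hg _ w u k0; have w0' := path_gt0 path w.
  rewrite -powRM; [|exact: ltW..]; apply: le_powR_comparable => //.
    exact: (path_gt0 path (cat_tuple w u)).
  exact: mulr_gt0.
by apply/andP; split; apply: ler_sum => u _; have /andP[] := h u.
Qed.

(** The number [G] given by [ext_sum_comparable] is common to all words of
    length [n], so that it cancels between numerator and denominator. *)
Lemma gibbs_ratio (q : R) (n k : nat) (w : n.-tuple 'I_b) :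
  (0 < n)%N -> (0 < k)%N ->
  ((C `^ `|q|) ^+ 2)^-1 * (mass w `^ q / partition_sum m q n) <=
    ext_sum q k w / partition_sum m q (n + k) <=
  (C `^ `|q|) ^+ 2 * (mass w `^ q / partition_sum m q n).
Proof.
move=> n0 k0; have [G [G0 hG]] := ext_sum_comparable q n0 k0.
set E := C `^ _ in hG *; have E0 : 0 < E by exact: powR_gt0.
have S0 := partition_sum_gt0 q n; have S0' := partition_sum_gt0 q (n + k).
have SE : E^-1 * (partition_sum m q n * G) <= partition_sum m q (n + k)
    <= E * (partition_sum m q n * G).
  rewrite partition_sum_ext {1 2}/partition_sum !mulr_suml !mulr_sumr.
  by apply/andP; split; apply: ler_sum => u _; have /andP[] := hG u.
move: SE S0 S0'; set S := partition_sum m q n; set S' := partition_sum _ _ _.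
move=> /andP[h1 h2] S0 S0'; have /andP[h3 h4] := hG w.
move: h3 h4; set T := ext_sum _ _ _; set pw := mass w `^ q => h3 h4.
have pw0 : 0 <= pw by exact: powR_ge0.
have h1' : S * G <= E * S' by move: h1; rewrite ler_pdivrMl.
have h3' : pw * G <= E * T by move: h3; rewrite ler_pdivrMl.
apply/andP; split.
  rewrite ler_pdivrMl ?exprn_gt0// ler_pdivrMr//.
  rewrite [leRHS](_ : _ = (E * T) * (E * S) / S'); last first.
    by field; rewrite lt0r_neq0.
  rewrite ler_pdivlMr// -(ler_pM2r G0).
  have : pw * G * S' <= E * T * (E * (S * G)).
    by apply: ler_pM => //; [rewrite mulr_ge0// ltW|exact: ltW].
  lra.
rewrite ler_pdivrMr// [leRHS](_ : _ = (E * pw) * (E * S') / S); last first.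
  by field; rewrite lt0r_neq0.
rewrite ler_pdivlMr// -(ler_pM2r G0).
have : T * (S * G) <= E * (pw * G) * (E * S').
  apply: ler_pM => //; last exact: mulr_ge0 (ltW S0) (ltW G0).
  by apply: sumr_ge0 => u _; exact: powR_ge0.
lra.
Qed.

End quasi_bernoulli_path.

(** * Weak limits of Gibbs measures *)

Section gibbs_limit.
Context {R : realType} (b : nat) (hb : (1 < b)%N).

Lemma continuous_head_word (n : nat) (g : n.-tuple 'I_b -> R) :
  continuous (fun t : symb hb => g (head_word t n)).
Proof.
by apply/(@continuousP (symb hb) R) => A _; exact: (@open_head_word b hb n R g A).
Qed.

(** Indicators of cylinders are continuous. *)
Lemma weak_limit_cyl (nu_ : nat -> {measure set (symb hb) -> \bar R})
    (nu : {measure set (symb hb) -> \bar R}) : weak_subseq_limit nu_ nu ->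
  exists phi : nat -> nat, {homo phi : i j / (i < j)%N} /\
    forall n (w : n.-tuple 'I_b),
      nu_ (phi k) (cyl w) @[k --> \oo] --> nu (cyl w).
Proof.
move=> [phi [phi_inc hphi]]; exists phi; split => // n w.
have := hphi _ (@continuous_head_word n (fun v => (v == w)%:R)).
have E (nu' : {measure set (symb hb) -> \bar R}) :
    (\int[nu']_t ((head_word t n == w)%:R)%:E = nu' (cyl w))%E.
  rewrite -(setIT (cyl w)) -integral_indic//; last exact: measurable_cyl.
  apply: eq_integral => t _; rewrite indicE; congr ((_ : bool)%:R%:E).
  by apply/idP/idP; rewrite cylE inE => /eqP.
rewrite E; under eq_fun do rewrite E.
by [].
Qed.

Variables (m ell nu : {measure set (symb hb) -> \bar R}) (C c : R).
Context (path : quasi_bernoulli_path m C c).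
Context (hell : forall (n : nat) (w : n.-tuple 'I_b),
  ell (cyl w) = (b%:R ^- n)%:E).
Variable q : R.
Context (hnu : weak_subseq_limit (fun n => gibbs m ell q n) nu).

Let A : R := (C `^ `|q|) ^+ 2.

Lemma gibbs_cat (n k : nat) (w : n.-tuple 'I_b) :
  gibbs m ell q (n + k) (cyl w) =
    (ext_sum m q k w / partition_sum m q (n + k))%:E.
Proof.
rewrite (measure_cyl_cat _ k w) /ext_sum mulr_suml -sumEFin.
by apply: eq_bigr => u _; exact: (@gibbs_cyl _ _ _ m ell q _ (cat_tuple w u)).
Qed.

(** The bounds of [gibbs_ratio] do not depend on [k], hence pass to the limit. *)
Lemma gibbs_limit_mass (n : nat) (w : n.-tuple 'I_b) : (0 < n)%N ->
  [/\ nu (cyl w) \is a fin_num,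
     A^-1 * (mass m w `^ q / partition_sum m q n) <= mass nu w &
     mass nu w <= A * (mass m w `^ q / partition_sum m q n)].
Proof.
move=> n0; have [phi [phi_inc /(_ _ w) hphi]] := weak_limit_cyl hnu.
have phi_ge k : (k <= phi k)%N.
  by elim: k => // k IH; exact: leq_ltn_trans IH (phi_inc _ _ (ltnSn k)).
set a := mass m w `^ q / _.
have near_bound : \forall k \near \oo,
    ((A^-1 * a)%:E <= gibbs m ell q (phi k) (cyl w) /\
    gibbs m ell q (phi k) (cyl w) <= (A * a)%:E)%E.
  exists n.+1 => // k /= nk.
  have -> : phi k = (n + (phi k - n))%N.
    by rewrite subnKC//; exact: leq_trans (ltnW nk) (phi_ge k).
  have k0 : (0 < phi k - n)%N by rewrite subn_gt0; exact: leq_trans nk (phi_ge k).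
  by rewrite gibbs_cat !lee_fin; apply/andP; exact: (gibbs_ratio path q w n0 k0).
have h1 : ((A^-1 * a)%:E <= nu (cyl w))%E.
  rewrite -(cvg_lim _ hphi)//; apply: lime_ge.
    by apply/cvg_ex; exists (nu (cyl w)).
  by move: near_bound; apply: filterS => k [].
have h2 : (nu (cyl w) <= (A * a)%:E)%E.
  rewrite -(cvg_lim _ hphi)//; apply: lime_le.
    by apply/cvg_ex; exists (nu (cyl w)).
  by move: near_bound; apply: filterS => k [].
have nufin : nu (cyl w) \is a fin_num.
  by rewrite ge0_fin_numE// (le_lt_trans h2)// ltry.
by rewrite /mass -!lee_fin fineK.
Qed.

(** Each of the [b >= 2] words obtained by adding a letter to a given one keeps
    at least a fraction [kappa] of its mass; so none has more than a fraction
    [1 - kappa]. *)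
Lemma gibbs_limit_decay : exists kappa : R, 0 < kappa < 1 /\
  forall (n k : nat) (w : n.-tuple 'I_b) (u : k.-tuple 'I_b), (0 < n)%N ->
    mass nu (w ++ u) <= (1 - kappa) ^+ k * mass nu w.
Proof.
have /andP[c0 c1] := path_c path.
have C1 := path_C1 path.
have A0 : 0 < A by rewrite exprn_gt0// powR_gt0// (lt_le_trans _ C1).
have A1 : 1 <= A by rewrite exprn_ege1// -(powRr0 C) ler_powR.
set d := c `^ `|q|.
have d0 : 0 < d by exact: powR_gt0.
have d1 : d <= 1 by rewrite -(powRr0 c) ger_powR// c0.
have b1 : 1 < b%:R :> R by rewrite ltr1n.
(* [d ^+ 2 / b] compares [mass m w `^ q / partition_sum m q n] for a word and for
   its extensions by a letter; [A ^+ 2] is the price of [gibbs_limit_mass]. *)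
pose kap := d ^+ 2 / (A ^+ 2 * b%:R).
have b0 : 0 < b%:R :> R by lra.
have kap0 : 0 < kap := divr_gt0 (exprn_gt0 2 d0) (mulr_gt0 (exprn_gt0 2 A0) b0).
have letter n (w : n.-tuple 'I_b) (r : 'I_b) : (0 < n)%N ->
    kap * mass nu w <= mass nu (w ++ [:: r]).
  move=> n0; have p0 := path_gt0 path w.
  have hpow (v : n.-tuple 'I_b) (s : 'I_b) :
      d * mass m v `^ q <= mass m (v ++ [:: s]) `^ q <= d^-1 * mass m v `^ q.
    have hcV : (c^-1 `^ `|q|)^-1 = d.
      by rewrite -powRN -powR_inv1 ?ltW// -powRrM mulN1r opprK.
    have -> : d^-1 = c^-1 `^ `|q| by rewrite -hcV invrK.
    rewrite -{1}hcV; apply: le_powR_comparable; rewrite ?invr_gt0//.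
    - exact: (path_gt0 path (cat_tuple v [tuple s])).
    - exact: (path_gt0 path v).
    rewrite invrK (path_letter path)/=.
    have h := mass_cat_le path v [tuple s].
    by rewrite (le_trans h)// ler_peMl ?(ltW (path_gt0 path v))// invf_ge1.
  have S0 := partition_sum_gt0 path q n.
  have S0' := partition_sum_gt0 path q (n + 1).
  have SS : partition_sum m q (n + 1) <= b%:R * d^-1 * partition_sum m q n.
    rewrite partition_sum_ext /partition_sum mulr_sumr.
    apply: ler_sum => v _; rewrite /ext_sum.
    apply: (@le_trans _ _ (\sum_(u : 1.-tuple 'I_b) d^-1 * mass m v `^ q)).
      apply: ler_sum => u _; case/tupleP: u => s u; rewrite tuple0.
      by have /andP[] := hpow v s.
    by rewrite sumr_const card_tuple card_ord expn1 -[leLHS]mulr_natl mulrA.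
  have n10 : (0 < n + 1)%N by rewrite addn1.
  have [_ h1 _] := gibbs_limit_mass (cat_tuple w [tuple r]) n10.
  have [_ _ h2] := gibbs_limit_mass w n0.
  apply: le_trans h1.
  apply: (@le_trans _ _ (kap * (A * (mass m w `^ q / partition_sum m q n)))).
    by rewrite ler_wpM2l// ltW.
  have /andP[h3 _] := hpow w r.
  rewrite [leLHS](_ : _ = A^-1 * (d * mass m w `^ q /
    (b%:R * d^-1 * partition_sum m q n))); last first.
    by rewrite /kap; field; rewrite !lt0r_neq0.
  rewrite ler_wpM2l ?invr_ge0 ?(ltW A0)//.
  apply: ler_pM => //.
  - by rewrite mulr_ge0 ?powR_ge0// ltW.
  - by rewrite invr_ge0 !mulr_ge0 ?invr_ge0// ltW.
  - by rewrite lef_pV2 ?posrE// !mulr_gt0 ?invr_gt0.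
exists kap.
have k01 : 0 < kap < 1.
  rewrite kap0 /= ltr_pdivrMr; last exact: mulr_gt0 (exprn_gt0 2 A0) b0.
  rewrite mul1r (@le_lt_trans _ _ 1)//; first by rewrite exprn_ile1// ltW.
  by apply: lt_le_trans b1 _; exact: ler_peMl (ltW b0) (exprn_ege1 2 A1).
clearbody kap; split => // n k w u n0; elim: k u => [|k IH] u.
  by rewrite tuple0 /= cats0 expr0 mul1r.
have [u' [r ->]] := tupleSr u; rewrite catA.
have nk0 : (0 < n + k)%N by rewrite addn_gt0 n0.
have n10 : (0 < n + k + 1)%N by rewrite addn1.
have [r' rr'] : exists r' : 'I_b, r' != r.
  have [r0|r0] := eqVneq r (Ordinal (ltnW hb)); last first.
    by exists (Ordinal (ltnW hb)); rewrite eq_sym.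
  by exists (Ordinal hb); rewrite r0.
have fin (s : 1.-tuple 'I_b) : nu (cyl (cat_tuple w u' ++ s)) \is a fin_num.
  by have [] := gibbs_limit_mass (cat_tuple (cat_tuple w u') s) n10.
have := mass_sum_cat fin; rewrite (bigD1 [tuple r])//= (bigD1 [tuple r'])/=; last first.
  by apply: contra rr' => /eqP/(congr1 val) /= [->].
have := letter _ (cat_tuple w u') r' nk0; have := IH u'; rewrite /=.
set x := mass nu (w ++ u'); set y := mass nu w.
set z := mass nu (_ ++ [:: r']); set z' := mass nu (_ ++ [:: r]) => h1 h2.
set rest := \sum_(i | _) _; have rest0 : 0 <= rest.
  by apply: sumr_ge0 => i _; rewrite /mass fine_ge0.
move=> h3; rewrite exprS -mulrA.
have /andP[_ k1] := k01.
have : (1 - kap) * x <= (1 - kap) * ((1 - kap) ^+ k * y).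
  by rewrite ler_wpM2l// subr_ge0 ltW.
by apply: le_trans; clearbody x y z z' rest; lra.
Qed.

End gibbs_limit.

(** * Typical words under a limit of Gibbs measures *)

(** Mean value theorem for [f], then differentiability of its derivative at
    [q]. *)
Lemma taylor_order2 (R : realType) (f : R -> R) (q : R) :
  (forall x, derivable f x 1) -> derivable (derive1 f) q 1 ->
  exists L h0 : R, [/\ 0 <= L, 0 < h0 & forall h, `|h| < h0 ->
    `|f (q + h) - f q - h * derive1 f q| <= L * h ^+ 2].
Proof.
move=> df /cvg_ex[g' /= /cvgrPdist_le /(_ 1 ltr01)].
move=> [h0 /= h00 near_q].
have g'P h : `|h| < h0 ->
    `|derive1 f (q + h) - derive1 f q| <= (`|g'| + 1) * `|h|.
  move=> hh; have [->|hn0] := eqVneq h 0.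
    by rewrite addr0 subrr normr0 mulr0.
  have := near_q h; rewrite /ball /= sub0r normrN => /(_ hh hn0).
  rewrite /GRing.scale /= mulr1 [h + q]addrC => H.
  have -> : derive1 f (q + h) - derive1 f q =
     h * (h^-1 * (derive1 f (q + h) - derive1 f q)) by rewrite mulrA divff// mul1r.
  rewrite normrM mulrC ler_wpM2r//.
  by rewrite -[X in `|X|](subKr g') (le_trans (ler_normB _ _))// lerD2l.
have isd (x : R) : is_derive x 1 f (derive1 f x).
  by apply: DeriveDef => //; rewrite derive1E.
have cf (a c : R) : {within `[a, c], continuous f}.
  apply: continuous_subspaceT => x; apply: differentiable_continuous.
  by apply/derivable1_diffP; exact: df.
exists (`|g'| + 1), h0; split => [||h hh]; [by rewrite addr_ge0|by []|].
have mvt : exists2 y, `|y - q| <= `|h| & f (q + h) - f q = derive1 f y * h.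
  have [h0'|h0'] := leP 0 h.
    have qh : q <= q + h by rewrite lerDl.
    have [y] := MVT_segment qh (fun x _ => isd x) (cf _ _).
    rewrite in_itv/= => /andP[y1 y2]; rewrite addrAC subrr add0r => e.
    by exists y => //; rewrite !ger0_norm//; lra.
  have qh : q + h <= q by rewrite gerDl ltW.
  have [y] := MVT_segment qh (fun x _ => isd x) (cf _ _).
  rewrite in_itv/= => /andP[y1 y2] e.
  by exists y; [rewrite !ler0_norm; lra|lra].
have [y yq ->] := mvt.
have -> : derive1 f y * h - h * derive1 f q = h * (derive1 f y - derive1 f q) by ring.
rewrite normrM -[h ^+ 2]ger0_norm ?sqr_ge0// expr2 normrM mulrCA.
rewrite ler_wpM2l//.
have := g'P (y - q) (le_lt_trans yq hh); rewrite [q + _]addrC subrK => /le_trans; apply.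
by rewrite ler_wpM2l// addr_ge0.
Qed.

Section gibbs_limit_estimates.
Context {R : realType} (b : nat) (hb : (1 < b)%N).
Variables (m ell nu : {measure set (symb hb) -> \bar R}) (C c : R).
Context (path : quasi_bernoulli_path m C c).
Context (hell : forall (n : nat) (w : n.-tuple 'I_b),
  ell (cyl w) = (b%:R ^- n)%:E).
Variable q : R.
Context (hnu : weak_subseq_limit (fun n => gibbs m ell q n) nu).
Context (nu1 : nu setT = 1%E).

Let A : R := (C `^ `|q|) ^+ 2.

(** Chernoff's inequality for the weights [mass m v `^ q / partition_sum m q n]:
    tilting them by [theta] replaces [q] with [q + theta]. *)
Lemma gibbs_limit_chernoff (theta x0 : R) (n : nat) : (0 < n)%N ->
  (nu [set t | (x0 <= theta * ln (mass m (head_word t n)))%R] <=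
    (A * expR (ln (partition_sum m (q + theta) n) - ln (partition_sum m q n)
      - x0))%:E)%E.
Proof.
move=> n0.
rewrite (measure_head_word nu (fun v => x0 <= theta * ln (mass m v))).
have S0 := partition_sum_gt0 path q n.
have S0' := partition_sum_gt0 path (q + theta) n.
have A0 : 0 <= A by rewrite exprn_ge0// powR_ge0.
apply: (@le_trans _ _ (\sum_(v : n.-tuple 'I_b)
   (A * (expR (- x0) * (mass m v `^ (q + theta) / partition_sum m q n)))%:E)%E).
  rewrite big_mkcond; apply: lee_sum => v _.
  have w0 := path_gt0 path v.
  have [hv|_] := ifPn; last first.
    by rewrite lee_fin !mulr_ge0 ?expR_ge0 ?powR_ge0// invr_ge0 ltW.
  have [nufin _ h2] := gibbs_limit_mass path hell hnu v n0.
  rewrite -(fineK nufin) lee_fin (le_trans h2)// ler_wpM2l//.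
  rewrite mulrA ler_wpM2r ?invr_ge0 ?(ltW S0)//.
  rewrite /powR gt_eqF// -expRD ler_expR; lra.
rewrite sumEFin lee_fin -mulr_sumr ler_wpM2l// -mulr_sumr -mulr_suml.
rewrite -/(partition_sum m (q + theta) n) !expRD !expRN !lnK ?posrE//.
by rewrite [leLHS]mulrC.
Qed.

(** Given the first [j] letters, each of the at most [2 * N] extremal tails has
    conditional mass at most [(1 - kappa) ^+ k]. *)
Lemma gibbs_limit_tails : exists kappa : R, 0 < kappa < 1 /\
  forall (j k N : nat), (0 < j)%N ->
    (nu [set t | [exists u : k.-tuple 'I_b,
        (drop j (head_word t (j + k)) == u) &&
        ((word_index u < N)%N || (b ^ k <= word_index u + N)%N)]] <=
      ((2 * N)%:R * (1 - kappa) ^+ k)%:E)%E.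
Proof.
have [kap [k01 hk]] := gibbs_limit_decay path hell hnu.
exists kap; split => // j k N j0.
pose ext (u : k.-tuple 'I_b) := (word_index u < N)%N || (b ^ k <= word_index u + N)%N.
rewrite (measure_head_word nu (fun w => [exists u : k.-tuple 'I_b,
        (drop j w == u) && ext u])).
rewrite big_mkcond big_tuple_cat.
have K0 : 0 <= (1 - kap) ^+ k by rewrite exprn_ge0// subr_ge0 ltW//; case/andP: k01.
apply: (@le_trans _ _ (\sum_(v : j.-tuple 'I_b)
    ((2 * N)%:R * (1 - kap) ^+ k)%:E * nu (cyl v))%E).
  apply: lee_sum => v _.
  have [vfin _ _] := gibbs_limit_mass path hell hnu v j0.
  apply: (@le_trans _ _ (\sum_(u | ext u) ((1 - kap) ^+ k)%:E * nu (cyl v))%E).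
    rewrite [leRHS]big_mkcond; apply: lee_sum => u _.
    have -> : [exists u' : k.-tuple 'I_b,
        (drop j (cat_tuple v u) == u') && ext u'] = ext u.
      apply/existsP/idP => [[u' /andP[/eqP]]|eu].
        by rewrite /= drop_size_cat ?size_tuple// => /val_inj <-.
      by exists u; rewrite /= drop_size_cat ?size_tuple// eqxx.
    case: ifP => // _.
    have jk0 : (0 < j + k)%N by rewrite addn_gt0 j0.
    have [ufin _ _] := gibbs_limit_mass path hell hnu (cat_tuple v u) jk0.
    by rewrite -(fineK ufin) -(fineK vfin) -EFinM lee_fin; exact: hk.
  rewrite -(fineK vfin) -EFinM sumEFin sumr_const -EFinM lee_fin -[leLHS]mulr_natl mulrA.
  rewrite ler_wpM2r ?fine_ge0// ler_wpM2r// ler_nat.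
  exact: card_extremal_tails.
rewrite -ge0_sume_distrr//.
have -> : (\sum_(v : j.-tuple 'I_b) nu (cyl v) = 1)%E.
  by rewrite -(measure_head_word nu (fun=> true)) -nu1; congr (nu _); apply/seteqP.
by rewrite mule1.
Qed.

(** A neighbour of [t] has the same first [j] letters unless the tail of [t] is
    extremal, and the mass of a word with these first letters is between
    [c ^+ k] times the mass of the prefix and that mass. *)
Lemma near_mass (j k N : nat) (t : symb hb) (w : (j + k).-tuple 'I_b) :
  (word_dist w (head_word t (j + k)) <= N)%N ->
  ~~ [exists u : k.-tuple 'I_b,
        (drop j (head_word t (j + k)) == u) &&
        ((word_index u < N)%N || (b ^ k <= word_index u + N)%N)] ->
  `|ln (mass m w) - ln (mass m (head_word t (j + k)))| <= k%:R * - ln c.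
Proof.
have /andP[c0 _] := path_c path.
have [u ->] := head_word_cat j k t; move: (head_word t j) => v.
have [p u'E] : exists p : j.-tuple 'I_b * k.-tuple 'I_b, w = cat_tuple p.1 p.2.
  have sj : size (take j w) == j by rewrite size_takel// size_tuple leq_addr.
  have sk : size (drop j w) == k by rewrite size_drop size_tuple addKn.
  by exists (Tuple sj, Tuple sk); apply: val_inj; rewrite /= cat_take_drop.
rewrite u'E => dN /existsPn/(_ u).
rewrite /= drop_size_cat ?size_tuple// eqxx /= => nu'.
have pv : p.1 = v.
  apply/eqP; apply: contraNT nu' => pv.
  by apply: far_prefix_tail dN pv.
rewrite pv.
have gt0 (u' : k.-tuple 'I_b) : 0 < mass m (v ++ u') := path_gt0 path (cat_tuple v u').
have v0 : 0 < mass m v := path_gt0 path v.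
have bd (u' : k.-tuple 'I_b) :
    k%:R * ln c + ln (mass m v) <= ln (mass m (v ++ u')) <= ln (mass m v).
  rewrite mulr_natl -lnXn// -lnM ?posrE ?exprn_gt0//.
  rewrite !ler_ln ?posrE ?mulr_gt0 ?exprn_gt0//.
  by rewrite (mass_cat_ge path) (mass_cat_le path).
have /andP[h1 h2] := bd u; have /andP[h3 h4] := bd p.2.
by rewrite ler_norml; apply/andP; split; lra.
Qed.

Lemma near_mass_sub (n k N : nat) (t : symb hb) (w : n.-tuple 'I_b) :
  (k <= n)%N -> (word_dist w (head_word t n) <= N)%N ->
  ~ [exists u : k.-tuple 'I_b,
        (drop (n - k) (head_word t (n - k + k)) == u) &&
        ((word_index u < N)%N || (b ^ k <= word_index u + N)%N)] ->
  `|ln (mass m w) - ln (mass m (head_word t n))| <= k%:R * - ln c.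
Proof.
move=> kn; move: (n - k)%N (subnK kn) => j jn; subst n.
by move=> dw /negP; exact: near_mass dw.
Qed.

End gibbs_limit_estimates.

(** The exponent in Chernoff's inequality near its minimum in the parameter. *)
Lemma chernoff_optimum (R : realType) (L e : R) : 0 <= L ->
  L * (e / (2 * (L + 1))) ^+ 2 - e / (2 * (L + 1)) * e <= - (e ^+ 2 / (4 * (L + 1))).
Proof.
move=> L0; have L1 : 0 < L + 1 by lra.
rewrite -subr_ge0 (_ : _ - _ = (e / (2 * (L + 1))) ^+ 2).
  exact: sqr_ge0.
by field; rewrite lt0r_neq0.
Qed.

Lemma chernoff_exponent (R : realType) (S1 S2 t1 t2 n l r D s eta be e E : R) :
  n * l * (t1 - t2 + s * eta * be - eta * e) <= n * l * - E ->
  0 <= l * r ->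
  - (S1 + n * (t1 * l)) <= D * r -> S1 + n * (t1 * l) <= D * r ->
  - (S2 + n * (t2 * l)) <= D * r -> S2 + n * (t2 * l) <= D * r ->
  S2 - S1 - (eta * (n * l * e) - s * eta * (n * (be * l))) <=
    (2 * D + l) * r - l * (n * E).
Proof. move=> *; lra. Qed.

Lemma tail_exponent (R : realType) (X Y k r th : R) :
  0 <= r -> Y <= X -> X <= th * (k + 1) -> - (k * th) <= th + (r - Y).
Proof. move=> *; lra. Qed.

Lemma tail_ratio (R : realType) (k d n e l L : R) :
  k * l <= d * (n * e) * l -> d * l * (n * e) <= L * (n * e) ->
  k * l <= n * L * e.
Proof. move=> *; lra. Qed.

Lemma typical_exponent (R : realType) (x y z k B : R) :
  y + z <= B -> - (y + z) <= B -> - (x - y) <= k -> x - y <= k -> k <= B ->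
  - (B + B) <= x + z /\ x + z <= B + B.
Proof. by move=> *; split; lra. Qed.

(** * Singularity sets along one realization *)

Section typical_points.
Context {R : realType} (b : nat) (hb : (1 < b)%N).
Variables (m ell : {measure set (symb hb) -> \bar R}).
Variables (nu : probability (symb hb) R) (C c : R).
Context (path : quasi_bernoulli_path m C c).
Context (hell : forall (n : nat) (w : n.-tuple 'I_b),
  ell (cyl w) = (b%:R ^- n)%:E).
Variable q : R.
Context (hnu : weak_subseq_limit (fun n => gibbs m ell q n) nu).
Variables (tau : R -> R) (N : nat) (eps : nat -> R).
Context (dtau : forall x, derivable tau x 1) (ddtau : derivable (derive1 tau) q 1).
Context (eps_gt0 : forall n, (1 <= n)%N -> 0 < eps n).
Context (eps_cvg0 : eps @ \oo --> (0 : R)).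
Context (hseries : forall M alpha : R, 0 < M -> 0 < alpha ->
    cvgn (fun n : nat => \sum_(1 <= k < n)
      b%:R `^ (M * k%:R `^ (3 / 4) * ln k%:R)
        * b%:R `^ (- (k%:R * alpha * eps k ^+ 2)))).

Let lb : R := ln b%:R.
Let rate (n : nat) : R := n%:R `^ (3 / 4) * ln n%:R.

Context (hest : forall Q : nat, exists D, 0 <= D /\ \forall n \near \oo,
  forall q', `|q'| <= Q%:R ->
    `|ln (partition_sum m q' n) + n%:R * (tau q' * lb)| <= D * rate n).

Let b1 : 1 < b%:R :> R. Proof. by rewrite ltr1n. Qed.
Let b0 : 0 < b%:R :> R. Proof. exact: lt_trans ltr01 b1. Qed.
Let lb0 : 0 < lb. Proof. exact: ln_gt0. Qed.

Let rate_ge0 n : (1 <= n)%N -> 0 <= rate n.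
Proof. by move=> n1; rewrite mulr_ge0 ?powR_ge0// ln_ge0// ler1n. Qed.

Let term_expR (M alpha : R) (n : nat) :
  b%:R `^ (M * n%:R `^ (3 / 4) * ln n%:R)
        * b%:R `^ (- (n%:R * alpha * eps n ^+ 2)) =
  expR (lb * (M * rate n - n%:R * alpha * eps n ^+ 2)) :> R.
Proof.
rewrite /powR (gt_eqF b0) -expRD -/lb; congr expR.
by rewrite /rate /powR; ring.
Qed.

Let eps_small (e : R) : 0 < e -> \forall n \near \oo, 0 < eps n <= e.
Proof.
move=> e0; move/cvgrPdist_le : eps_cvg0 => /(_ _ e0).
apply: filterS2 (nbhs_infty_ge 1) => n n1; rewrite sub0r normrN => h.
by rewrite eps_gt0//= (le_trans (ler_norm _) h).
Qed.

(** The general term of a convergent series is eventually less than [1], so its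
    exponent is eventually negative. *)
Lemma rate_small (M : R) : 0 < M ->
  \forall n \near \oo, M * rate n <= n%:R * eps n ^+ 2.
Proof.
move=> M0; have := hseries M0 ltr01.
set S := (fun n : nat => _) => hS.
have : (fun n => S n.+1 - S n) @ \oo --> (0 : R).
  rewrite -(subrr (limn S)); apply: cvgB => //.
  by rewrite (cvg_shiftS S).
move=> /cvgrPdist_lt/(_ _ ltr01).
apply: filterS2 (nbhs_infty_ge 1) => n n1; rewrite sub0r normrN.
rewrite /S big_nat_recr//= addrAC subrr add0r.
rewrite term_expR ger0_norm ?expR_ge0// expR_lt1 pmulr_rlt0// subr_lt0 mulr1.
exact: ltW.
Qed.

Lemma borel_cantelli_rate (B : nat -> set (symb hb)) (K M alpha : R) :
  (forall n, measurable (B n)) -> 0 <= K -> 0 < M -> 0 < alpha ->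
  (\forall n \near \oo, (nu (B n) <=
    (K * expR (lb * (M * rate n - n%:R * alpha * eps n ^+ 2)))%:E)%E) ->
  \forall t \ae nu, \forall n \near \oo, ~ B n t.
Proof.
move=> mB K0 M0 a0 [n0 _ hn0].
pose f n := K * expR (lb * (M * rate n - n%:R * alpha * eps n ^+ 2)).
have f0 n : (1 <= n)%N -> 0 <= f n by move=> _; rewrite mulr_ge0// expR_ge0.
have fcvg : cvgn (fun n => \sum_(1 <= k < n) f k).
  rewrite (_ : (fun n => _) = (fun n => K * \sum_(1 <= k < n)
      expR (lb * (M * rate k - k%:R * alpha * eps k ^+ 2)))); last first.
    by apply/funext => n; rewrite mulr_sumr.
  apply: is_cvgMr; have := hseries M0 a0.
  by under eq_fun do under eq_bigr do rewrite term_expR.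
have := borel_cantelli_dominated (P := nu) mB f0 fcvg hn0.
by apply: filterS => t [p [_ hp]]; exists p.
Qed.

Section level.
Variable tol : R.
Context (tol_gt0 : 0 < tol).
Let beta := derive1 tau q.
Let e (n : nat) : R := tol / 2 * eps n.
Let S n q' := ln (partition_sum m q' n).
Let lp n (t : symb hb) : R := ln (mass m (head_word t n)).

(** The factor [s] is a sign: for [s = 1] the mass is too large, for [s = - 1] it
    is too small. *)
Let chernoff_set (s : R) n : set (symb hb) :=
  [set t | n%:R * lb * e n < s * (lp n t + n%:R * (beta * lb))].

Let measurable_chernoff_set s n : measurable (chernoff_set s n).
Proof.
apply: sub_sigma_algebra.
exact: (@open_head_word b hb n R
  (fun v => s * (ln (mass m v) + n%:R * (beta * lb)))
  [set y | n%:R * lb * e n < y]).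
Qed.

(** By Taylor's formula, a Chernoff parameter [eta] proportional to [e n] gives
    the exponent [- alpha * n * eps n ^+ 2], up to the error [2 * D * rate n] on
    the partition sums: the resulting bounds are terms of the series. *)
Let level_chernoff (s : R) : s ^+ 2 = 1 ->
  \forall t \ae nu, \forall n \near \oo, ~ chernoff_set s n t.
Proof.
move=> s2.
have [L [h0 [L0 h00 taylor]]] := taylor_order2 dtau ddtau.
pose Q := (Num.truncn (`|q| + 1)).+1.
have qQ : `|q| + 1 < Q%:R.
  by have /andP[] := truncn_itv (addr_ge0 (normr_ge0 q) (@ler01 R)).
have [D [D0 estD]] := hest Q.
have k20 : 0 < tol / 2 by rewrite divr_gt0.
(* Both Taylor's formula, on [[- h0, h0]], and the estimate on partition sums,
   on [[- Q, Q]], have to apply at [q + th]. *)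
pose h1 := Num.min (h0 / 2) 1; have h10 : 0 < h1 by rewrite lt_min ltr01 divr_gt0.
have M0 : 0 < 2 * D / lb + 1 by rewrite ltr_pwDr// divr_ge0 ?mulr_ge0// ltW.
have L10 : 0 < 4 * (L + 1) by lra.
have a0 : 0 < (tol / 2) ^+ 2 / (4 * (L + 1)) by rewrite divr_gt0// exprn_gt0.
have A0 : 0 <= (C `^ `|q|) ^+ 2 by rewrite exprn_ge0// powR_ge0.
apply: (borel_cantelli_rate (measurable_chernoff_set s) A0 M0 a0).
have eps_s := eps_small (divr_gt0 (mulr_gt0 h10 (ltr_wpDl L0 (@ltr01 R))) k20).
move: estD eps_s (nbhs_infty_ge 1); apply: filterS3 => n estn /andP[en0 en1] n1.
have ee0 : 0 < e n by rewrite mulr_gt0.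
have een : e n <= h1 * (L + 1) by rewrite /e mulrC -ler_pdivlMr.
pose eta := e n / (2 * (L + 1)).
have eta0 : 0 <= eta by rewrite divr_ge0 ?ltW//; lra.
have etae : eta * (2 * (L + 1)) = e n by rewrite /eta divfK// lt0r_neq0//; lra.
have etah1 : eta <= h1 / 2.
  have : eta * (2 * (L + 1)) <= h1 / 2 * (2 * (L + 1)) by rewrite etae; lra.
  by rewrite ler_pM2r//; lra.
have h1h0 : h1 <= h0 / 2 by rewrite ge_min lexx.
have h11 : h1 <= 1 by rewrite ge_min lexx orbT.
pose th := s * eta.
have s1 : `|s| = 1.
  by apply/eqP; rewrite -sqrp_eq1// -normrX s2 normr1.
have thE : `|th| = eta by rewrite normrM s1 mul1r ger0_norm.
have th2 : th ^+ 2 = eta ^+ 2 by rewrite exprMn s2 mul1r.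
have := taylor th; rewrite thE th2 -/beta => /(_ ltac:(lra)) tay.
have est1 := estn q ltac:(lra).
have est2 : `|S n (q + th) + n%:R * (tau (q + th) * lb)| <= D * rate n.
  by apply: estn; rewrite (le_trans (ler_normD _ _))// thE; lra.
rewrite -/(S n q) in est1.
pose x0 := eta * (n%:R * lb * e n) - th * (n%:R * (beta * lb)).
apply: (@le_trans _ _ (nu [set t | (x0 <= th * lp n t)%R])).
  apply: le_measure; rewrite ?inE; first exact: measurable_chernoff_set.
    apply: sub_sigma_algebra.
    exact: (@open_head_word b hb n R (fun v => th * ln (mass m v)) [set y | x0 <= y]).
  move=> t; rewrite /chernoff_set /= => ht.
  have := ler_wpM2l eta0 (ltW ht); rewrite /x0 /th.
  move: (eta) (n%:R) (lp n t) => ? ? ?; lra.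
apply: (le_trans (gibbs_limit_chernoff path hell hnu _ _ n1)).
rewrite lee_fin ler_wpM2l// ler_expR -/(S n (q + th)) -/(S n q).
have n0 : 0 < n%:R :> R by rewrite ltr0n.
have r0 := rate_ge0 n1.
have lbM : lb * (2 * D / lb + 1) = 2 * D + lb.
  by rewrite mulrDr mulr1 mulrCA divff ?mulr1// lt0r_neq0.
have key : tau q - tau (q + th) + th * beta - eta * e n <= - (e n ^+ 2 / (4 * (L + 1))).
  have := chernoff_optimum (e n) L0; rewrite -/eta.
  move: tay => /ler_normlP[t1 _] t2; move: (eta * e n) t1 t2 => ? ? ?; lra.
have enE : (tol / 2) ^+ 2 / (4 * (L + 1)) * eps n ^+ 2 = e n ^+ 2 / (4 * (L + 1)).
  by rewrite /e [(tol / 2 * eps n) ^+ 2]exprMn mulrAC.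
have nlb : 0 <= n%:R * lb by rewrite mulr_ge0 ?ltW.
have key' := ler_wpM2l nlb key.
rewrite -[n%:R * _ * eps n ^+ 2]mulrA enE mulrBr [lb * (_ * rate n)]mulrA lbM.
have lbr : 0 <= lb * rate n by rewrite mulr_ge0// ltW.
move: est1 est2 => /ler_normlP[u1 u2] /ler_normlP[u3 u4].
move: key' lbr u1 u2 u3 u4; rewrite /x0 /th.
exact: chernoff_exponent.
Qed.

(** The factor [delta] is such that changing the last [delta * n * e n] letters
    of a word of length [n] changes the logarithm of its mass by at most
    [n * lb * e n]; being less than [1], it makes the tails shorter than the
    words. *)
Let delta : R := lb / (1 + lb - ln c).
Let tail_len (n : nat) : nat := Num.truncn (delta * (n%:R * e n)).
Let tail_set (n : nat) : set (symb hb) :=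
  let k := tail_len n in let j := (n - k)%N in
  [set t | [exists u : k.-tuple 'I_b,
        (drop j (head_word t (j + k)) == u) &&
        ((word_index u < N)%N || (b ^ k <= word_index u + N)%N)]].

Let lnc : ln c <= 0.
Proof. by apply: ln_le0; have /andP[] := path_c path. Qed.

Let delta_gt0 : 0 < delta.
Proof. by rewrite divr_gt0//; move: lnc lb0; clearbody lb; lra. Qed.

Let delta_lt1 : delta < 1.
Proof.
by rewrite ltr_pdivrMr; move: lnc lb0; clearbody lb; lra.
Qed.

Let delta_ln : delta * - ln c <= lb.
Proof.
rewrite mulrAC ler_pdivrMr; last by move: lnc lb0; clearbody lb; lra.
by rewrite ler_wpM2l ?(ltW lb0)//; move: lb0; clearbody lb; lra.
Qed.

Let e_small (x : R) : 0 < x -> \forall n \near \oo, 0 < e n <= x.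
Proof.
move=> x0; have k20 : 0 < tol / 2 by rewrite divr_gt0.
have := eps_small (divr_gt0 x0 k20); apply: filterS => n /andP[en0 en1].
by rewrite mulr_gt0//= /e mulrC -ler_pdivlMr.
Qed.

Let tail_len_itv n : 0 < e n ->
  (tail_len n)%:R <= delta * (n%:R * e n) < (tail_len n).+1%:R.
Proof.
move=> e0; apply: truncn_itv.
by rewrite (mulr_ge0 (ltW delta_gt0))// mulr_ge0// ltW.
Qed.

Let tail_len_lt : \forall n \near \oo, (tail_len n < n)%N.
Proof.
move: (e_small ltr01) (nbhs_infty_ge 1); apply: filterS2 => n /andP[e0 e1] n1.
have /andP[h _] := tail_len_itv e0.
have n0 : 0 < n%:R :> R by rewrite ltr0n.
rewrite -(ltr_nat R); apply: le_lt_trans h _.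
apply: (@le_lt_trans _ _ (delta * n%:R)).
  by rewrite ler_wpM2l ?(ltW delta_gt0)// ger_pMr.
by rewrite gtr_pMl// delta_lt1.
Qed.

Let measurable_tail_set n : measurable (tail_set n).
Proof.
apply: sub_sigma_algebra.
exact: (@open_head_word b hb (n - tail_len n + tail_len n) bool
  (fun w => [exists u : (tail_len n).-tuple 'I_b,
        (drop (n - tail_len n) w == u) &&
        ((word_index u < N)%N || (b ^ tail_len n <= word_index u + N)%N)])
  [set x | x]).
Qed.

(** The probability is exponentially small in [n * eps n], which eventually
    exceeds [n * eps n ^+ 2]. *)
Let level_tails : \forall t \ae nu, \forall n \near \oo, ~ tail_set n t.
Proof.
have [kap [/andP[k0 k1] hk]] := gibbs_limit_tails path hell hnu (probability_setT nu).
pose th := - ln (1 - kap).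
have th0 : 0 < th by rewrite oppr_gt0 ln_lt0//; lra.
have powE k : (1 - kap) ^+ k = expR (- (k%:R * th)).
  by rewrite /th mulrN opprK mulr_natl -lnXn ?lnK ?posrE ?exprn_gt0//; lra.
have K0 : 0 <= (2 * N)%:R * expR th by rewrite mulr_ge0// expR_ge0.
have k20 : 0 < tol / 2 by rewrite divr_gt0.
have a0 : 0 < delta * th * (tol / 2) / lb :=
  divr_gt0 (mulr_gt0 (mulr_gt0 delta_gt0 th0) k20) lb0.
apply: (borel_cantelli_rate measurable_tail_set K0 ltr01 a0).
have e_s := e_small ltr01; have eps_s := eps_small ltr01.
have eps_s1 : \forall n \near \oo, 0 < eps n <= 1 /\ (1 <= n)%N.
  by move: eps_s (nbhs_infty_ge 1); apply: filterS2.
move: e_s tail_len_lt eps_s1; apply: filterS3 => n.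
move=> /andP[e0 e1] kn [/andP[eps0 eps1] n1].
apply: (le_trans (hk (n - tail_len n)%N (tail_len n) N _)); first by rewrite subn_gt0.
rewrite lee_fin -mulrA ler_wpM2l// powE -expRD ler_expR.
have /andP[_ h] := tail_len_itv e0.
have r0 : 0 <= lb * (1 * rate n) by rewrite mul1r mulr_ge0 ?(ltW lb0)// rate_ge0.
rewrite mulrBr.
have -> : lb * (n%:R * (delta * th * (tol / 2) / lb) * eps n ^+ 2) =
   th * (delta * (n%:R * e n)) * eps n.
  by rewrite /e; field; rewrite lt0r_neq0.
have h2 : th * (delta * (n%:R * e n)) * eps n <= th * (delta * (n%:R * e n)).
  have n0 : 0 < n%:R :> R by rewrite ltr0n.
  by rewrite (ger_pMr _ (mulr_gt0 th0 (mulr_gt0 delta_gt0 (mulr_gt0 n0 e0)))).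
have h3 : th * (delta * (n%:R * e n)) <= th * (tail_len n).+1%:R.
  by rewrite ler_wpM2l ?(ltW th0)// ltW.
by move: h3; rewrite -[_.+1%:R]natr1; exact: tail_exponent r0 h2.
Qed.

(** One half of the tolerance [tol * eps n] is for the deviation of the mass of
    the word of [t] itself, the other half for passing to its neighbours. *)
Lemma level_set_typical : \forall t \ae nu, \forall n \near \oo,
  forall w : n.-tuple 'I_b, (word_dist w (head_word t n) <= N)%N ->
    `|ln (mass m w) + n%:R * (derive1 tau q * lb)| <= n%:R * lb * (tol * eps n).
Proof.
have cp := level_chernoff (expr1n R 2).
have cm := level_chernoff (etrans (sqrrN 1) (expr1n R 2)).
apply: filterS3 cp cm level_tails => t cpt cmt tt.
have e_s := e_small ltr01.
have cpm : \forall n \near \oo, ~ chernoff_set 1 n t /\ ~ chernoff_set (- 1) n t.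
  by move: cpt cmt; apply: filterS2.
have e_s' : \forall n \near \oo, 0 < e n <= 1 /\ (tail_len n < n)%N.
  by move: e_s tail_len_lt; apply: filterS2.
move: cpm tt e_s'; apply: filterS3 => n [cpn cmn] ttn [/andP[e0 e1] kn] w dw.
have /andP[h _] := tail_len_itv e0.
have kN : (tail_len n)%:R * - ln c <= n%:R * lb * e n.
  have ne0 : 0 <= n%:R * e n by rewrite mulr_ge0// ltW.
  have lnc' : 0 <= - ln c by rewrite oppr_ge0.
  exact: tail_ratio (ler_wpM2r lnc' h) (ler_wpM2r ne0 delta_ln).
have near_w : `|ln (mass m w) - lp n t| <= (tail_len n)%:R * - ln c.
  exact: (near_mass_sub path (ltnW kn) dw ttn).
have e2 : tol * eps n = e n + e n by rewrite /e; lra.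
move: cpn cmn; rewrite /chernoff_set /= => /negP; rewrite -leNgt mul1r => h1.
move=> /negP; rewrite -leNgt mulN1r => h2.
rewrite e2 mulrDr; move: near_w => /ler_normlP[h3 h4].
rewrite ler_norml -/beta.
by apply/andP; exact: typical_exponent h1 h2 h3 h4 kN.
Qed.

End level.

Lemma gibbs_limit_level n (w : n.-tuple 'I_b) : (1 <= n)%N ->
  `|ln (mass nu w) - (q * ln (mass m w) - ln (partition_sum m q n))|
    <= ln ((C `^ `|q|) ^+ 2).
Proof.
move=> n1; have [nufin h1 h2] := gibbs_limit_mass path hell hnu w n1.
have A0 : 0 < (C `^ `|q|) ^+ 2.
  by rewrite exprn_gt0// powR_gt0// (lt_le_trans _ (path_C1 path)).
have w0 := path_gt0 path w; have S0 := partition_sum_gt0 path q n.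
have x0 : 0 < mass m w `^ q / partition_sum m q n by rewrite divr_gt0// powR_gt0.
have nu0 : 0 < mass nu w.
  by apply: lt_le_trans h1; rewrite mulr_gt0// invr_gt0.
have -> : q * ln (mass m w) - ln (partition_sum m q n) =
    ln (mass m w `^ q / partition_sum m q n).
  by rewrite ln_div ?posrE ?powR_gt0// ln_powR.
by apply: ln_comparable => //; apply/andP.
Qed.

(** By [gibbs_limit_level] the deviation for [nu] is at most [`|q|] times the
    deviation for [m], plus the error on the partition sum: [level_set_typical]
    is used with [tol = (2 * (`|q| + 1))^-1], and [rate_small] for the rest. *)
Lemma gibbs_limit_typical : \forall t \ae nu, \forall n \near \oo,
  forall w : n.-tuple 'I_b, (word_dist w (head_word t n) <= N)%N ->
    `|ln (mass nu w) + n%:R * ((derive1 tau q * q - tau q) * lb)|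
      <= n%:R * lb * eps n.
Proof.
pose beta := derive1 tau q; rewrite -/beta.
have q1 : 0 < 2 * (`|q| + 1) by rewrite mulr_gt0// ltr_pwDr.
have k0 : 0 < (2 * (`|q| + 1))^-1 by rewrite invr_gt0.
pose Q := (Num.truncn `|q|).+1.
have qQ : `|q| <= Q%:R by have /andP[_ /ltW] := truncn_itv (normr_ge0 q).
have [D [D0 estD]] := hest Q.
set A := ln ((C `^ `|q|) ^+ 2).
have A0 : 0 <= A.
  by apply: ln_ge0; rewrite exprn_ege1// -(powRr0 C) ler_powR// (path_C1 path).
have M0 : 0 < 2 * (D + A + 1) / lb by rewrite divr_gt0// mulr_gt0//; lra.
have good : \forall n \near \oo,
  [/\ (1 <= n)%N, D * rate n + A <= n%:R * lb * (eps n / 2) &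
    `|ln (partition_sum m q n) + n%:R * (tau q * lb)| <= D * rate n].
  have eps_s := eps_small ltr01; have rs := rate_small M0.
  have e1 : \forall n \near \oo, (1 <= n)%N /\ 1 <= rate n.
    exists (maxn 1 (Num.truncn (expR 1 : R)).+1) => // n /=.
    rewrite geq_max => /andP[n1 en]; split => //.
    have [s1 s2 srho rho2] := powR34 R n1.
    have ln1 : 1 <= ln n%:R :> R.
      rewrite -ler_expR lnK ?posrE ?ltr0n//.
      have /andP[_ /ltW/le_trans] := truncn_itv (expR_ge0 (1 : R)); apply.
      by rewrite ler_nat.
    by rewrite -[leLHS]mulr1; apply: ler_pM => //; exact: le_trans s1 srho.
  have er : \forall n \near \oo, 0 < eps n <= 1 /\
      2 * (D + A + 1) / lb * rate n <= n%:R * eps n ^+ 2.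
    by move: eps_s rs; apply: filterS2.
  move: estD e1 er; apply: filterS3 => n estn [n1 r1] [/andP[en0 en1] rn].
  split => //; last exact: estn.
  have n0 : 0 <= n%:R * eps n by rewrite mulr_ge0// ltW.
  have h1 : n%:R * eps n ^+ 2 <= n%:R * eps n by rewrite expr2 mulrA ler_piMr.
  have h2 : 2 * (D + A + 1) * rate n <= n%:R * eps n * lb.
    rewrite -ler_pdivrMr// mulrAC; exact: le_trans rn h1.
  have h3 : A <= A * rate n by rewrite ler_peMr.
  have h4 : 0 <= rate n by lra.
  by move: h2 h3 h4; move: (rate n) (lb) => r l; lra.
have := level_set_typical k0; apply: filterS => t.
move: good; apply: filterS2 => n [n1 DA estn] lev w dw.
have hw := lev w dw; have hnuw := gibbs_limit_level w n1.
rewrite -/A in hnuw; rewrite -/beta in hw.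
set x := ln (mass nu w) in hnuw *; set y := ln (mass m w) in hnuw hw.
set S := ln (partition_sum _ _ _) in estn hnuw.
have -> : x + n%:R * ((beta * q - tau q) * lb) =
    (x - (q * y - S)) + (q * (y + n%:R * (beta * lb)) -
      (S + n%:R * (tau q * lb))) by move: (lb) => l; ring.
apply: le_trans (ler_normD _ _) _; apply: le_trans (lerD hnuw (ler_normB _ _)) _.
have hq : `|q * (y + n%:R * (beta * lb))| <= n%:R * lb * (eps n / 2).
  rewrite normrM; apply: le_trans (ler_wpM2l (normr_ge0 q) hw) _.
  have -> : `|q| * (n%:R * lb * ((2 * (`|q| + 1))^-1 * eps n)) =
      n%:R * lb * (eps n / 2) * (`|q| / (`|q| + 1)).
    by move: (lb) => l; field; rewrite lt0r_neq0// ltr_pwDr.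
  have D1 : 0 <= D * rate n by rewrite mulr_ge0// rate_ge0.
  rewrite ler_piMr//; first exact: le_trans (addr_ge0 D1 A0) DA.
  by rewrite ler_pdivrMr ?ltr_pwDr// mul1r lerDl.
have e2 : n%:R * lb * eps n = n%:R * lb * (eps n / 2) + n%:R * lb * (eps n / 2).
  by move: (lb) => l; field.
rewrite e2; move: estn hq DA; move: (_ * (eps n / 2)) => Z.
move: (D * rate n) => W; move: `|_| `|_| => u v *; lra.
Qed.

(** Singularity sets are measurable because each of the countably many
    conditions depends on finitely many letters. *)
Lemma singularity_set_full (m' : {measure set (symb hb) -> \bar R}) (B : R) :
  (forall n (w : n.-tuple 'I_b), (1 <= n)%N ->
    m' (cyl w) \is a fin_num /\ 0 < mass m' w) ->
  (\forall t \ae nu, \forall n \near \oo, forall w : n.-tuple 'I_b,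
    (word_dist w (head_word t n) <= N)%N ->
    `|ln (mass m' w) + n%:R * (B * lb)| <= n%:R * lb * eps n) ->
  nu (singularity_set m' B N eps) = 1%E.
Proof.
move=> m'P level; set S := singularity_set _ _ _ _.
have mS : measurable S.
  apply: bigcup_measurable => p _.
  rewrite /singularity_set_from.
  pose Y n (v : n.-tuple 'I_b) : Prop := (p <= n)%N -> forall w : n.-tuple 'I_b,
     (word_dist w v <= N)%N ->
     ((b%:R `^ (- (n%:R * (B + eps n))))%:E <= m' (cyl w) /\
      m' (cyl w) <= (b%:R `^ (- (n%:R * (B - eps n))))%:E)%E.
  rewrite (_ : [set t | _] = \bigcap_n [set t : symb hb | Y n (head_word t n)]).
    apply: bigcap_measurable => // n _; apply: sub_sigma_algebra.
    exact: (@open_head_word b hb n Prop (Y n) [set x | x]).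
  by apply/seteqP; split => t /= ht n; [move=> _; exact: ht|exact: ht].
have nS : nu (~` S) = 0%E.
  apply/negligibleP; first exact: measurableC.
  move: level; apply: negligibleS => t /= nSt near_t; apply: nSt.
  have [n0 _ hn0] := near_t.
  exists (maxn 1 n0); first by rewrite /= leq_maxl.
  move=> n; rewrite geq_max => /andP[n1 n0n] w dw.
  have [m'fin w0] := m'P n w n1; have := hn0 n n0n w dw.
  rewrite -(fineK m'fin) !lee_fin -/(mass m' w) /powR (gt_eqF b0) -/lb.
  rewrite -{2 3}(lnK (x := mass m' w)) ?posrE// !ler_expR.
  move=> /ler_normlP[h1 h2].
  by split; move: h1 h2; move: (lb) (ln (mass _ _)) => l y; lra.
by rewrite -(setCK S) probability_setC ?nS ?sube0//; exact: measurableC.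
Qed.

Theorem gibbs_limit_singularity_sets :
  nu (singularity_set nu (derive1 tau q * q - tau q) N eps) = 1%E /\
  nu (singularity_set m (derive1 tau q) N eps) = 1%E.
Proof.
split; apply: singularity_set_full.
- move=> n w n1; have [nufin h1 _] := gibbs_limit_mass path hell hnu w n1.
  split => //; apply: lt_le_trans h1.
  have C0 : 0 < C by rewrite (lt_le_trans _ (path_C1 path)).
  have A0 : 0 < (C `^ `|q|) ^+ 2 := exprn_gt0 2 (powR_gt0 _ C0).
  apply: mulr_gt0; first by rewrite invr_gt0.
  exact: divr_gt0 (powR_gt0 _ (path_gt0 path w)) (partition_sum_gt0 path q n).
- exact: gibbs_limit_typical.
- by move=> n w _; split; [exact: (path_fin path)|exact: (path_gt0 path)].
- have := level_set_typical ltr01; apply: filterS => t; apply: filterS => n.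
  by move=> h w dw; have := h w dw; rewrite mul1r.
Qed.

End typical_points.

(** * Partition sums as functions of the exponent *)

Section partition_sum_lipschitz.
Context {R : realType} (b : nat) (hb : (1 < b)%N).
Variables (m : {measure set (symb hb) -> \bar R}) (C c : R).
Context (path : quasi_bernoulli_path m C c) (m1 : m setT = 1%E).

Lemma cyl_nil : cyl (hb := hb) [::] = setT.
Proof. by apply/seteqP; split => // t _; apply: size0nil; rewrite size_tuple. Qed.

Lemma ln_mass_bounds n (w : n.-tuple 'I_b) :
  - (n%:R * - ln c) <= ln (mass m w) <= 0.
Proof.
have /andP[c0 _] := path_c path; have w0 := path_gt0 path w.
have m0 : mass m [::] = 1 by rewrite /mass cyl_nil m1.
have := mass_cat_ge path [tuple] w; have := mass_cat_le path [tuple] w.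
rewrite /= m0 mulr1 => h1 h2.
rewrite ln_le0// andbT mulrN opprK mulr_natl -lnXn// ler_ln// posrE exprn_gt0//.
Qed.

(** The masses of words of length [n] are between [c ^+ n] and [1], so each
    term is multiplied by at most [expR (- n * ln c * `|q - q'|)]. *)
Lemma le_ln_partition_sum n (q q' : R) :
  ln (partition_sum m q n) <=
    ln (partition_sum m q' n) + n%:R * (- ln c * `|q - q'|).
Proof.
have S0 := partition_sum_gt0 path q n; have S0' := partition_sum_gt0 path q' n.
rewrite -[X in _ + X]expRK -lnM ?posrE ?expR_gt0// ler_ln ?posrE ?mulr_gt0 ?expR_gt0//.
rewrite /partition_sum mulr_suml; apply: ler_sum => w _.
have w0 := path_gt0 path w; have /andP[h1 h2] := ln_mass_bounds w.
rewrite -/(mass m w) /powR gt_eqF// -expRD ler_expR.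
rewrite -lerBlDl -mulrBl (le_trans (ler_norm _))// normrM mulrC mulrA.
by rewrite ler_wpM2r// ler0_norm// lerNl.
Qed.

Lemma ln_partition_sum_lip n (q q' : R) :
  `|ln (partition_sum m q n) - ln (partition_sum m q' n)| <=
    n%:R * (- ln c * `|q - q'|).
Proof.
have := le_ln_partition_sum n q' q; rewrite [`|q' - q|]distrC.
have := le_ln_partition_sum n q q'.
by rewrite ler_norml => h1 h2; apply/andP; split; lra.
Qed.

Lemma ln_partition_sum_bound n (q : R) :
  `|ln (partition_sum m q n)| <= n%:R * (ln b%:R + - ln c * `|q|).
Proof.
have e0 : ln (partition_sum m 0 n) = n%:R * ln b%:R.
  rewrite /partition_sum (eq_bigr (fun=> 1)) => [|w _]; last by rewrite powRr0.
  rewrite sumr_const card_tuple card_ord natrX lnXn ?mulr_natl//.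
  by rewrite ltr0n ltnW.
have := ln_partition_sum_lip n q 0; rewrite subr0 e0 => h.
rewrite -[X in `|X|](subrK (n%:R * ln b%:R)) (le_trans (ler_normD _ _))//.
have lb0 : 0 <= ln b%:R :> R by rewrite ln_ge0// ler1n ltnW.
by rewrite mulrDr addrC lerD// ger0_norm// mulr_ge0.
Qed.

End partition_sum_lipschitz.

(** * Random variables that depend on families of masses *)

Section generated.
Context {R : realType}.

Definition coordinate (I : Type) (i : I) (f : I -> \bar R) : \bar R := f i.

(** The sets [B] with this property form a sigma-algebra. *)
Lemma generated_sigma_preimage (I T : Type) (X : I -> T -> \bar R)
    (B : set (I -> \bar R)) :
  generated_sigma (@coordinate I) B -> generated_sigma X [set x | B (X ^~ x)].
Proof.
have [s0 sC sU] := @smallest_sigma_algebra T setT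
  (\bigcup_i preimage_set_system setT (X i) measurable).
pose G := [set B : set (I -> \bar R) | generated_sigma X [set x | B (X ^~ x)]].
suff : <<s \bigcup_i preimage_set_system setT (@coordinate I i) measurable >> `<=` G.
  by apply.
apply: smallest_sub => /=.
  split.
  - exact: s0.
  - move=> A GA; have := sC _ GA; rewrite /G /= /generated_sigma.
    by congr (<<s _ >> _); rewrite !setTD.
  - by move=> F GF; exact: (sU (fun k => [set x | F k (X ^~ x)]) GF).
move=> A [i _ [Y mY <-]]; apply: sub_sigma_algebra; exists i => //.
by exists Y.
Qed.

(** The logarithm of a partition sum as a function on the space of families of
    masses: its law under mu and mu^(j), and its independence under mu_j and
    mu^(j), are then instances of the hypotheses on these families. *)
Definition log_sum (I : Type) (J : finType) (h : J -> I) (q : R)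
    (f : I -> \bar R) : R := ln (\sum_(u : J) fine (f (h u)) `^ q).

Lemma log_sum_generated (I : Type) (J : finType) (h : J -> I) (q : R) (A : set R) :
  measurable A ->
  generated_sigma (@coordinate I) (log_sum h q @^-1` A).
Proof.
move=> mA.
pose T := g_sigma_algebraType
  (\bigcup_i preimage_set_system setT (@coordinate I i) measurable).
have mcoord i : measurable_fun setT (@coordinate I i : T -> \bar R).
  move=> _ Y mY; rewrite setTI; apply: sub_sigma_algebra; exists i => //.
  by exists Y => //; rewrite setTI.
have mF : measurable_fun setT (log_sum h q : T -> R).
  apply: measurableT_comp; first exact: measurable_ln.
  apply: measurable_sum => u.
  apply: (measurableT_comp (measurable_powR _)).
  by apply: measurableT_comp => //; exact: mcoord.
by have := mF measurableT _ mA; rewrite setTI.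
Qed.

End generated.

(** * From the decomposition to a realization *)

Lemma ln_sum_powR_dist (R : realType) (J : finType) (x y : J -> R) (q K : R)
    (j0 : J) :
  (forall j, 0 < x j) -> (forall j, 0 < y j) ->
  (forall j, `|ln (x j) - ln (y j)| <= K) ->
  `|ln (\sum_j x j `^ q) - ln (\sum_j y j `^ q)| <= `|q| * K.
Proof.
have sum_gt0 (z : J -> R) : (forall j, 0 < z j) -> 0 < \sum_j z j `^ q.
  move=> z0; rewrite (bigD1 j0)//= ltr_wpDr// ?powR_gt0//.
  by apply: sumr_ge0 => j _; exact: powR_ge0.
have le (z t : J -> R) : (forall j, 0 < z j) -> (forall j, 0 < t j) ->
    (forall j, `|ln (z j) - ln (t j)| <= K) ->
    ln (\sum_j z j `^ q) <= ln (\sum_j t j `^ q) + `|q| * K.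
  move=> z0 t0 ztK.
  rewrite -[X in _ + X]expRK -lnM ?posrE ?expR_gt0 ?sum_gt0//.
  rewrite ler_ln ?posrE ?mulr_gt0 ?expR_gt0 ?sum_gt0//.
  rewrite mulr_suml; apply: ler_sum => j _.
  rewrite /powR !gt_eqF// -expRD ler_expR -lerBlDl -mulrBr.
  by rewrite (le_trans (ler_norm _))// normrM ler_wpM2l.
move=> x0 y0 xyK; have h1 := le _ _ x0 y0 xyK.
have h2 : ln (\sum_j y j `^ q) <= ln (\sum_j x j `^ q) + `|q| * K.
  by apply: le => // j; rewrite distrC.
by rewrite ler_norml; apply/andP; split; lra.
Qed.

Section path_of_decomposition.
Context {R : realType} (b : nat) (hb : (1 < b)%N).
Variables (m : {measure set (symb hb) -> \bar R}).
Variables (l g : nat -> {measure set (symb hb) -> \bar R}) (C c0 : R).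
Context (C1 : 1 <= C) (c00 : 0 < c0 <= 1) (m1 : m setT = 1%E).
Context (first_letter : forall u : 1.-tuple 'I_b, (c0%:E <= m (cyl u))%E).
Context (decomp : forall j k (v : j.-tuple 'I_b) (u : k.-tuple 'I_b),
  (0 < j)%N -> (0 < k)%N ->
  (C^-1%:E * l j (cyl v) * g j (cyl u) <= m (cyl (v ++ u)) /\
   m (cyl (v ++ u)) <= C%:E * l j (cyl v) * g j (cyl u))%E).
Context (next_letter : forall j (u : 1.-tuple 'I_b), (0 < j)%N ->
  (c0%:E <= g j (cyl u))%E).
Context (g1 : forall j, (0 < j)%N ->
  (\sum_(u : 1.-tuple 'I_b) g j (cyl u) = 1)%E).

Let C0 : 0 < C. Proof. exact: lt_le_trans ltr01 C1. Qed.

Let mfin n (w : n.-tuple 'I_b) : m (cyl w) \is a fin_num.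
Proof.
rewrite ge0_fin_numE//; apply: (@le_lt_trans _ _ (m setT)); last by rewrite m1 ltry.
by apply: le_measure; rewrite ?inE//; exact: measurable_cyl.
Qed.

Let gT j : (0 < j)%N -> g j setT = 1%E.
Proof.
by move=> j0; rewrite -cyl_nil (measure_cyl_cat (g j) 1 [tuple]) -(g1 j0).
Qed.

Let gfin j n (w : n.-tuple 'I_b) : (0 < j)%N -> g j (cyl w) \is a fin_num.
Proof.
move=> j0; rewrite ge0_fin_numE//.
apply: (@le_lt_trans _ _ (g j setT)); last by rewrite gT// ltry.
by apply: le_measure; rewrite ?inE//; exact: measurable_cyl.
Qed.

(** Sum the decomposition over the letters that follow [v]: the total mass of
    [g j] is [1]. *)
Let l_bounds j (v : j.-tuple 'I_b) : (0 < j)%N ->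
  (C^-1%:E * l j (cyl v) <= m (cyl v) /\ m (cyl v) <= C%:E * l j (cyl v))%E.
Proof.
move=> j0; rewrite (measure_cyl_cat m 1 v).
rewrite -[(C^-1%:E * _)%E]mule1 -[(C%:E * _)%E]mule1 -(g1 j0).
rewrite !ge0_sume_distrr//.
by split; apply: lee_sum => u _; have [] := decomp v u j0 (ltn0Sn 0).
Qed.

Let lfin j (v : j.-tuple 'I_b) : (0 < j)%N -> l j (cyl v) \is a fin_num.
Proof.
move=> j0; have [h _] := l_bounds v j0; rewrite ge0_fin_numE//.
move: h; case: (l j (cyl v)) => [r _|h|//]; first exact: ltry.
have := le_lt_trans h; rewrite gt0_muley ?lte_fin ?invr_gt0//.
by move=> /(_ +oo)%E; rewrite ltxx => ->//; rewrite -ge0_fin_numE.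
Qed.

Let lmass j (v : j.-tuple 'I_b) : (0 < j)%N ->
  C^-1 * mass (l j) v <= mass m v <= C * mass (l j) v.
Proof.
move=> j0; have [] := l_bounds v j0.
rewrite -(fineK (mfin v)) -(fineK (lfin v j0)) -!EFinM !lee_fin => h1 h2.
by apply/andP.
Qed.

Let dmass j k (v : j.-tuple 'I_b) (u : k.-tuple 'I_b) : (0 < j)%N -> (0 < k)%N ->
  C^-1 * (mass (l j) v * mass (g j) u) <= mass m (v ++ u)
    <= C * (mass (l j) v * mass (g j) u).
Proof.
move=> j0 k0; have [] := decomp v u j0 k0.
rewrite -(fineK (mfin (cat_tuple v u))) -(fineK (lfin v j0)) -(fineK (gfin u j0)).
by rewrite -!EFinM !lee_fin !mulrA => h1 h2; apply/andP.
Qed.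

Let mass_ge0 (m' : {measure set (symb hb) -> \bar R}) w : 0 <= mass m' w.
Proof. by rewrite /mass fine_ge0. Qed.

Let two_step j k (v : j.-tuple 'I_b) (u : k.-tuple 'I_b) : (0 < j)%N -> (0 < k)%N ->
  (C * C)^-1 * (mass m v * mass (g j) u) <= mass m (v ++ u)
    <= (C * C) * (mass m v * mass (g j) u).
Proof.
move=> j0 k0; have /andP[h1 h2] := lmass v j0; have /andP[h3 h4] := dmass v u j0 k0.
have g0 := mass_ge0 (g j) u.
apply/andP; split.
  apply: le_trans h3; rewrite invfM -mulrA ler_wpM2l ?invr_ge0 ?(ltW C0)//.
  by rewrite mulrA ler_wpM2r// ler_pdivrMl.
apply: (le_trans h4); rewrite -mulrA ler_wpM2l ?(ltW C0)// mulrA ler_wpM2r//.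
by rewrite -ler_pdivrMl.
Qed.

Let letter n (w : n.-tuple 'I_b) (r : 'I_b) :
  c0 / (C * C) * mass m w <= mass m (w ++ [:: r]).
Proof.
have /andP[c0' c1] := c00.
have CC : 0 < C * C by rewrite mulr_gt0.
case: n w => [|n] w.
  rewrite tuple0 /= /mass cyl_nil m1 /= mulr1.
  have := first_letter [tuple r]; rewrite -(fineK (mfin [tuple r])) lee_fin.
  apply: le_trans; rewrite ler_pdivrMr// ler_peMr ?(ltW c0')//.
  by rewrite -[leLHS]mulr1 ler_pM.
have /andP[h _] := two_step w [tuple r] (ltn0Sn n) (ltn0Sn 0).
apply: le_trans h; rewrite [c0 / _]mulrC -mulrA ler_pM2l ?invr_gt0// mulrC.
rewrite ler_wpM2l//.
by have := next_letter [tuple r] (ltn0Sn n); rewrite -(fineK (gfin _ _)) ?lee_fin.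
Qed.

Let mass_gt0 n (w : n.-tuple 'I_b) : 0 < mass m w.
Proof.
elim: n w => [|n IH] w; first by rewrite tuple0 /= /mass cyl_nil m1 ltr01.
have [w' [r ->]] := tupleSr w; apply: lt_le_trans (letter w' r).
by have /andP[c0' _] := c00; rewrite mulr_gt0// divr_gt0// mulr_gt0.
Qed.

Let l_gt0 j (v : j.-tuple 'I_b) : (0 < j)%N -> 0 < mass (l j) v.
Proof.
move=> j0; have /andP[_ h] := lmass v j0.
by have := lt_le_trans (mass_gt0 v) h; rewrite pmulr_rgt0.
Qed.

Let g_gt0 j k (u : k.-tuple 'I_b) : (0 < j)%N -> (0 < k)%N -> 0 < mass (g j) u.
Proof.
move=> j0 k0; pose v : j.-tuple 'I_b := nseq_tuple j (Ordinal (ltnW hb)).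
have /andP[_ h] := dmass v u j0 k0.
have := lt_le_trans (mass_gt0 (cat_tuple v u)) h.
by rewrite pmulr_rgt0// pmulr_rgt0// l_gt0.
Qed.

Lemma path_of_decomposition : quasi_bernoulli_path m (C * C) (c0 / (C * C)).
Proof.
have /andP[c0' c1] := c00.
have CC1 : 1 <= C * C by rewrite -[leLHS]mulr1 ler_pM.
have CC : 0 < C * C by rewrite mulr_gt0.
split => //.
- rewrite divr_gt0//= ler_pdivrMr// mul1r; exact: le_trans c1 CC1.
- move=> j j0; exists (mass (g j)) => k v u k0; split; first exact: g_gt0.
  exact: two_step.
Qed.

Lemma ln_left_sum (q : R) j : (0 < j)%N ->
  `|ln (\sum_(v : j.-tuple 'I_b) mass (l j) v `^ q) - ln (partition_sum m q j)|
    <= `|q| * ln C.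
Proof.
move=> j0; pose v0 : j.-tuple 'I_b := nseq_tuple j (Ordinal (ltnW hb)).
apply: (ln_sum_powR_dist _ v0) => v.
- exact: l_gt0.
- exact: mass_gt0.
- by rewrite distrC; apply: ln_comparable (lmass v j0) => //; exact: l_gt0.
Qed.

Lemma ln_partition_sum_split (q : R) j k : (0 < j)%N -> (0 < k)%N ->
  `|ln (partition_sum m q (j + k)) -
    (ln (\sum_(v : j.-tuple 'I_b) mass (l j) v `^ q) +
     ln (\sum_(u : k.-tuple 'I_b) mass (g j) u `^ q))| <= `|q| * ln C.
Proof.
move=> j0 k0.
pose v0 : j.-tuple 'I_b := nseq_tuple j (Ordinal (ltnW hb)).
pose u0 : k.-tuple 'I_b := nseq_tuple k (Ordinal (ltnW hb)).
have l0 : 0 < \sum_(v : j.-tuple 'I_b) mass (l j) v `^ q.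
  rewrite (bigD1 v0)//= ltr_wpDr// ?powR_gt0 ?l_gt0//.
  by apply: sumr_ge0 => w _; exact: powR_ge0.
have gg0 : 0 < \sum_(u : k.-tuple 'I_b) mass (g j) u `^ q.
  rewrite (bigD1 u0)//= ltr_wpDr// ?powR_gt0 ?g_gt0//.
  by apply: sumr_ge0 => w _; exact: powR_ge0.
rewrite -lnM ?posrE// /partition_sum big_tuple_cat big_distrlr /= !pair_big /=.
rewrite [X in _ - ln X](eq_bigr (fun p : j.-tuple 'I_b * k.-tuple 'I_b =>
  (mass (l j) p.1 * mass (g j) p.2) `^ q)); last first.
  by move=> p _; rewrite powRM.
apply: (ln_sum_powR_dist _ (v0, u0)) => [p|p|p].
- exact: (mass_gt0 (cat_tuple p.1 p.2)).
- by rewrite mulr_gt0// ?l_gt0// g_gt0.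
apply: (ln_comparable C0 (mass_gt0 (cat_tuple p.1 p.2)) _ (dmass p.1 p.2 j0 k0)).
by rewrite mulr_gt0// ?l_gt0// g_gt0.
Qed.

End path_of_decomposition.

(** * The process of partition sums of a quasi-Bernoulli measure *)

Section transfer.
Context d {Om : measurableType d} {R : realType} (P : probability Om R).

Lemma measurable_generated_sigma (I : Type) (X : I -> Om -> \bar R) (A : set Om) :
  (forall i, measurable_fun setT (X i)) -> generated_sigma X A -> measurable A.
Proof.
move=> mX; have : <<s \bigcup_i preimage_set_system setT (X i) measurable >>
    `<=` (@measurable _ Om).
  apply: smallest_sub; first exact: sigma_algebra_measurable.
  by move=> _ [i _ [Y mY <-]]; exact: mX.
exact.
Qed.

Lemma same_distribution_ae (I : Type) (X Y : I -> Om -> \bar R)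
    (B : set (I -> \bar R)) :
  (forall i, measurable_fun setT (X i)) -> (forall i, measurable_fun setT (Y i)) ->
  same_distribution P X Y -> generated_sigma (@coordinate R I) B ->
  (\forall x \ae P, B (Y ^~ x)) -> \forall x \ae P, B (X ^~ x).
Proof.
move=> mX mY XY gB BY.
have mBX : measurable [set x | B (X ^~ x)].
  apply: measurable_generated_sigma mX _; exact: generated_sigma_preimage.
have mBY : measurable [set x | B (Y ^~ x)].
  apply: measurable_generated_sigma mY _; exact: generated_sigma_preimage.
have PY : P (~` [set x | B (Y ^~ x)]) = 0%E.
  by apply/negligibleP => //; exact: measurableC.
have PX : P (~` [set x | B (X ^~ x)]) = 0%E.
  by rewrite probability_setC// XY// -probability_setC.
by move/negligibleP : PX; apply; exact: measurableC.
Qed.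

Lemma common_lower_bound (J : finType) (f : J -> Om -> \bar R) :
  (forall j, (0 < ess_inf P (f j))%E) ->
  exists c0 : R, 0 < c0 <= 1 /\ \forall x \ae P, forall j, (c0%:E <= f j x)%E.
Proof.
move=> f0.
have one j : exists c : R, 0 < c /\ \forall x \ae P, (c%:E <= f j x)%E.
  have := f0 j; have := ess_inf_le P (f j).
  case: (ess_inf P (f j)) => [r|//|//] h; first by rewrite lte_fin; exists r.
  move=> _; exists 1; split => //; move: h; apply: filterS => x.
  by apply: le_trans; rewrite leey.
have /choice[c hc] := one.
have [c0 [c01 c0c]] : exists c0 : R, 0 < c0 <= 1 /\ forall j, j \in enum J -> c0 <= c j.
  elim: (enum J) => [|j s [c1 [/andP[c10 c11] IH]]]; first by exists 1; rewrite ltr01 lexx.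
  exists (Num.min c1 (c j)); rewrite lt_min c10 (hc j).1 ge_min c11; split => // i.
  by rewrite inE ge_min => /orP[/eqP ->|/IH ->//]; rewrite lexx orbT.
exists c0; split => //; apply: filter_forall => j.
have := (hc j).2; apply: filterS => x; apply: le_trans.
by rewrite lee_fin c0c// mem_enum.
Qed.

End transfer.

Lemma same_law_log_sum d (Om : measurableType d) (R : realType)
    (P : probability Om R) (I : Type) (X Y : I -> Om -> \bar R) (J : finType)
    (h : J -> I) (q : R) : same_distribution P X Y ->
  same_law P (fun x => log_sum h q (X ^~ x)) (fun x => log_sum h q (Y ^~ x)).
Proof. by move=> XY A mA; exact: XY _ (log_sum_generated h q mA). Qed.

Lemma independent_log_sum d (Om : measurableType d) (R : realType)
    (P : probability Om R) (I I' : Type) (X : I -> Om -> \bar R)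
    (Y : I' -> Om -> \bar R) (J J' : finType) (h : J -> I) (h' : J' -> I') (q : R) :
  independent_sigma P (generated_sigma X) (generated_sigma Y) ->
  independent_rv P (fun x => log_sum h q (X ^~ x)) (fun x => log_sum h' q (Y ^~ x)).
Proof.
move=> XY A B mA mB.
exact: (XY _ _ (generated_sigma_preimage (log_sum_generated h q mA))
  (generated_sigma_preimage (log_sum_generated h' q mB))).
Qed.

Lemma measurable_log_sum d (Om : measurableType d) (R : realType)
    (I : Type) (X : I -> Om -> \bar R) (J : finType) (h : J -> I) (q : R) :
  (forall i, measurable_fun setT (X i)) ->
  measurable_fun setT (fun x => log_sum h q (X ^~ x)).
Proof.
move=> mX _ A mA; rewrite setTI; apply: (measurable_generated_sigma mX).
exact: (generated_sigma_preimage (log_sum_generated h q mA)).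
Qed.

Section quasi_bernoulli_measure.
Context d {Om : measurableType d} {R : realType} (P : probability Om R).
Context (b : nat) (hb : (1 < b)%N) (mu : R.-pker Om ~> symb hb).

Lemma tuple_nonempty (k : nat) (u : k.+1.-tuple 'I_b) : tval u != [::].
Proof. by rewrite -size_eq0 size_tuple. Qed.

Definition nonempty_of_tuple (k : nat) (u : k.+1.-tuple 'I_b) : nonempty_word b :=
  exist _ (tval u) (tuple_nonempty u).

(** The lower bound on the masses of the letters and the total mass [1] are
    inherited by mu^(j), which has the law of mu.  Almost surely they hold,
    together with the decomposition, for all [j] at once, and the bounds along a
    realization follow.  The factor [C * C] comes from the decomposition, and
    from the comparison of mu_j with mu. *)
Theorem quasi_bernoulli_process : quasi_bernoulli P mu ->
  exists C c : R, [/\ 1 <= C, 0 < c <= 1,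
    \forall x \ae P, quasi_bernoulli_path (mu x) (C * C) c,
    forall q n, (0 < n)%N ->
      measurable_fun setT (fun x => ln (partition_sum (mu x) q n)) &
    forall q, quasi_additive P (`|q| * ln C)
      (fun n x => ln (partition_sum (mu x) q n))].
Proof.
move=> [C' [muL [muR [C'0 H]]]].
(* Enlarging the constant keeps the decomposition and makes [ln C >= 0]. *)
pose C := Num.max C' 1.
have C1 : 1 <= C by rewrite le_max lexx orbT.
have C0 : 0 < C by exact: lt_le_trans C1.
have mcyl n (w : n.-tuple 'I_b) (k : R.-ker Om ~> symb hb) :
    measurable_fun setT (fun x => k x (cyl w)).
  exact: measurable_kernel (measurable_cyl w).
have mword (w : nonempty_word b) (k : R.-ker Om ~> symb hb) :
    measurable_fun setT (fun x => k x (cyl (val w))).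
  exact: (mcyl _ (in_tuple (val w))).
have [c0 [c01 first]] : exists c0 : R, 0 < c0 <= 1 /\ \forall x \ae P,
    forall u : 1.-tuple 'I_b, (c0%:E <= mu x (cyl u))%E.
  apply: common_lower_bound => u; case/tupleP: u => r u; rewrite tuple0.
  by have [_ /(_ r)[h _] _ _] := H 1%N isT.
pose B (f : nonempty_word b -> \bar R) : Prop :=
  (forall u : 1.-tuple 'I_b, c0%:E <= f (nonempty_of_tuple u))%E /\
  (\sum_(u : 1.-tuple 'I_b) f (nonempty_of_tuple u) = 1)%E.
have gB : generated_sigma (@coordinate R (nonempty_word b)) B.
  pose T := g_sigma_algebraType
    (\bigcup_i preimage_set_system setT (@coordinate R (nonempty_word b) i) measurable).
  have mcoord i : measurable_fun setT (@coordinate R (nonempty_word b) i : T -> \bar R).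
    move=> _ Y mY; rewrite setTI; apply: sub_sigma_algebra; exists i => //.
    by exists Y => //; rewrite setTI.
  have : measurable ((\bigcap_(u in [set: 1.-tuple 'I_b])
      (@coordinate R _ (nonempty_of_tuple u) @^-1` [set y | (c0%:E <= y)%E])) `&`
    ((fun f : T => \sum_(u : 1.-tuple 'I_b)
      coordinate (nonempty_of_tuple u) f)%E @^-1` [set 1%E]) : set T).
    apply: measurableI.
      apply: fin_bigcap_measurable => // u _.
      rewrite -[X in measurable X]setTI; apply: mcoord => //.
      rewrite (_ : [set _ | _] = [set` `[c0%:E, +oo[]); first exact: emeasurable_itv.
      by apply/seteqP; split => y; rewrite /= in_itv/= andbT.
    rewrite -[X in measurable X]setTI.
    have : measurable_fun setT (fun f : T => \sum_(u : 1.-tuple 'I_b)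
      coordinate (nonempty_of_tuple u) f)%E by exact: emeasurable_sum.
    by apply => //; exact: emeasurable_set1.
  rewrite (_ : _ `&` _ = B)//.
  apply/seteqP; split => f [h1 h2]; split => //.
    by move=> u; exact: (h1 u).
  by move=> u _; exact: (h1 u).
have muB : \forall x \ae P, B (fun w => mu x (cyl (val w))).
  move: first; apply: filterS => x hx; split => [u|]; first exact: hx.
  by rewrite -(measure_cyl_cat (mu x) 1 [tuple]) cyl_nil prob_kernel.
have muRB j : (0 < j)%N -> \forall x \ae P, B (fun w => muR j x (cyl (val w))).
  move=> j0; have [_ _ hd _] := H j j0.
  by apply: (same_distribution_ae _ _ hd gB muB) => w; exact: mword.
have all_j : \forall x \ae P, forall j, (0 < j)%N ->
    (forall (v : j.-tuple 'I_b) (w : nonempty_word b),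
        (C^-1%:E * muL j x (cyl v) * muR j x (cyl (val w))
           <= mu x (cyl (v ++ val w)) /\
         mu x (cyl (v ++ val w))
           <= C%:E * muL j x (cyl v) * muR j x (cyl (val w)))%E) /\
    B (fun w => muR j x (cyl (val w))).
  apply: ae_foralln => j; case: (posnP j) => [->|j0]; first exact: aeW.
  have [hd _ _ _] := H j j0; move: hd (muRB j j0); apply: filterS2 => x hd hB _.
  split => // v w; have [h1 h2] := hd v w.
  have CC' : C' <= C by rewrite le_max lexx.
  split.
    apply: le_trans h1; rewrite lee_wpmul2r// lee_wpmul2r// lee_fin.
    by rewrite lef_pV2 ?posrE.
  by apply: (le_trans h2); rewrite lee_wpmul2r// lee_wpmul2r// lee_fin.
have all_x : \forall x \ae P,
   quasi_bernoulli_path (mu x) (C * C) (c0 / (C * C)) /\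
   forall q j k, (0 < j)%N -> (0 < k)%N ->
   `|ln (\sum_(v : j.-tuple 'I_b) mass (muL j x) v `^ q) - ln (partition_sum (mu x) q j)|
    <= `|q| * ln C /\
   `|ln (partition_sum (mu x) q (j + k)) -
    (ln (\sum_(v : j.-tuple 'I_b) mass (muL j x) v `^ q) +
     ln (\sum_(u : k.-tuple 'I_b) mass (muR j x) u `^ q))| <= `|q| * ln C.
  move: first all_j; apply: filterS2 => x fx hx.
  have dec j k (v : j.-tuple 'I_b) (u : k.-tuple 'I_b) : (0 < j)%N -> (0 < k)%N ->
    (C^-1%:E * muL j x (cyl v) * muR j x (cyl u) <= mu x (cyl (v ++ u)) /\
     mu x (cyl (v ++ u)) <= C%:E * muL j x (cyl v) * muR j x (cyl u))%E.
    by case: k u => // k u j0 _; exact: ((hx j j0).1 v (nonempty_of_tuple u)).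
  have nl j (u : 1.-tuple 'I_b) : (0 < j)%N -> (c0%:E <= muR j x (cyl u))%E.
    by move=> j0; exact: ((hx j j0).2.1 u).
  have g1 j : (0 < j)%N -> (\sum_(u : 1.-tuple 'I_b) muR j x (cyl u) = 1)%E.
    by move=> j0; exact: (hx j j0).2.2.
  have m1 : mu x setT = 1%E by exact: prob_kernel.
  split; first exact: (path_of_decomposition C1 c01 m1 fx dec nl g1).
  move=> q j k j0 k0; split.
    exact: (ln_left_sum C1 c01 m1 fx dec nl g1 q j0).
  exact: (ln_partition_sum_split C1 c01 m1 fx dec nl g1 q j0 k0).
have CC0 : 0 < C * C by rewrite mulr_gt0.
have CC1 : 1 <= C * C by rewrite -[leLHS]mulr1 ler_pM.
exists C, (c0 / (C * C)); split => //.
- have /andP[c0' c1] := c01; rewrite divr_gt0//= ler_pdivrMr// mul1r.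
  exact: le_trans CC1.
- by move: all_x; apply: filterS => x [].
- move=> q [//|n] _.
  exact: (@measurable_log_sum _ Om R _ (fun w x => mu x (cyl (val w))) _
    (@nonempty_of_tuple n) q).
move=> q j [//|k] j0 _; have [_ _ same indep] := H j j0.
exists (fun x => log_sum (id : j.-tuple 'I_b -> _) q (fun v => muL j x (cyl v))).
exists (fun x => log_sum (@nonempty_of_tuple k) q (fun w => muR j x (cyl (val w)))).
split.
- exact: (@measurable_log_sum _ Om R _ (fun v x => muL j x (cyl (tval v)))).
- exact: (@measurable_log_sum _ Om R _ (fun w x => muR j x (cyl (val w)))).
- exact: (independent_log_sum id (@nonempty_of_tuple k) q indep).
- exact: (same_law_log_sum (@nonempty_of_tuple k) q same).
by move: all_x; apply: filterS => x [_ /(_ q j k.+1 j0 (ltn0Sn k))].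
Qed.

End quasi_bernoulli_measure.

(** * Conclusion *)

Lemma quasi_additive_le d (Om : measurableType d) (R : realType)
    (P : probability Om R) (c c' : R) (Z : nat -> Om -> R) :
  c <= c' -> quasi_additive P c Z -> quasi_additive P c' Z.
Proof.
move=> cc' qZ j k j0 k0; have [X [Y [mX mY iXY YZ XZ]]] := qZ j k j0 k0.
exists X, Y; split => //; move: XZ; apply: filterS => x [h1 h2].
by split; apply: le_trans cc'.
Qed.

(** [a] is the limit of [ln S_n(q) / n] obtained from the means, and [t] the
    value of the lower limit that defines [tau]. *)
Lemma tau_of_limit (R : realType) (b : nat) (hb : (1 < b)%N)
    (m : {measure set (symb hb) -> \bar R}) (q t a : R) (r : nat -> R) :
  tau_of m q = t%:E -> r @ \oo --> (0 : R) ->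
  (\forall n \near \oo, `|ln (partition_sum m q n) - n%:R * a| <= n%:R * r n) ->
  a = - (t * ln b%:R).
Proof.
move=> tauE r0 near_r.
have lb0 : 0 < ln b%:R :> R by rewrite ln_gt0// ltr1n.
pose u (j : nat) : R := - (j%:R^-1 * (ln (partition_sum m q j) / ln b%:R)).
have ul : u @ \oo --> - (a / ln b%:R).
  apply/cvgrPdist_le => e e0.
  have el0 : 0 < e * ln b%:R by rewrite mulr_gt0.
  move/cvgrPdist_le : r0 => /(_ _ el0) r0.
  move: r0 near_r (nbhs_infty_ge 1); apply: filterS3 => n rn hn n1.
  rewrite sub0r normrN in rn.
  have n0 : 0 < n%:R :> R by rewrite ltr0n.
  have -> : - (a / ln b%:R) - u n =
      (ln (partition_sum m q n) - n%:R * a) / (n%:R * ln b%:R).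
    by rewrite /u; field; rewrite !lt0r_neq0.
  rewrite normrM normfV [`|_ * ln _|]gtr0_norm ?mulr_gt0//.
  rewrite ler_pdivrMr ?mulr_gt0// (le_trans hn)// mulrCA ler_pM2l//.
  exact: le_trans (ler_norm _) rn.
have ule : (u j)%:E @[j --> \oo] --> (- (a / ln b%:R))%:E.
  by apply: cvg_EFin => //; exact: nearW.
have := tauE; rewrite /tau_of -/u.
rewrite is_cvg_limn_einfE; last by apply/cvg_ex; exists (- (a / ln b%:R))%:E.
rewrite (cvg_lim _ ule)// => -[<-].
by rewrite mulNr opprK divfK// lt0r_neq0.
Qed.


(** The deviation bounds are needed on every interval [[- Q, Q]] with [Q] an
    integer, hence on countably many events; along a realization that belongs
    to all of them, the parameters [q] are treated one at a time. *)
Theorem theorem1 (R : realType) (d : measure_display) (Om : measurableType d)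
  (P : probability Om R) (b : nat) (hb : (1 < b)%N)
  (ell : probability (symb hb) R)
  (hell : forall (n : nat) (w : n.-tuple 'I_b),
    ell (cyl w) = (b%:R ^- n)%:E)
  (mu : R.-pker Om ~> symb hb) (hmu : quasi_bernoulli P mu)
  (tau : R -> R)
  (htau : \forall x \ae P, forall q : R, tau_of (mu x) q = (tau q)%:E)
  (tau_derivable : forall q : R, derivable tau q 1)
  (tau_derivable2 : forall q : R, derivable (derive1 tau) q 1)
  (tau_continuous2 : continuous (derive1 (derive1 tau)))
  (muq : R -> Om -> probability (symb hb) R)
  (hmuq : \forall x \ae P, forall q : R,
    weak_subseq_limit (fun n => gibbs (mu x) ell q n) (muq q x))
  (N : nat) (hN : (1 <= N)%N)
  (eps : nat -> R) (eps_gt0 : forall n, (1 <= n)%N -> 0 < eps n)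
  (eps_cvg0 : eps @ \oo --> (0 : R))
  (hseries : forall M alpha : R, 0 < M -> 0 < alpha ->
    cvgn (fun n : nat => \sum_(1 <= k < n)
      b%:R `^ (M * k%:R `^ (3 / 4) * ln k%:R)
        * b%:R `^ (- (k%:R * alpha * eps k ^+ 2)))) :
  \forall x \ae P, forall q : R, 0 < derive1 tau q * q - tau q ->
    muq q x (singularity_set (muq q x) (derive1 tau q * q - tau q) N eps) = 1%E /\
    muq q x (singularity_set (mu x) (derive1 tau q) N eps) = 1%E.
Proof.
have [C [c [C1 /andP[c0 c1] path mZ qZ]]] := quasi_bernoulli_process hmu.
have lnC : 0 <= ln C by exact: ln_ge0.
have lnc : 0 <= - ln c by rewrite oppr_ge0 ln_le0.
have lb0 : 0 <= ln b%:R :> R by rewrite ln_ge0// ler1n ltnW.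
have m1 x : mu x setT = 1%E by exact: prob_kernel.
pose Z q n x := ln (partition_sum (mu x) q n).
pose M0 (Q : nat) := ln b%:R + - ln c * Q%:R.
pose cQ (Q : nat) := Q%:R * ln C.
pose D (Q : nat) := 6 * (2 * M0 Q + 2 * cQ Q + 1) + 2 * - ln c.
have M00 Q : 0 <= M0 Q by rewrite addr_ge0// mulr_ge0.
have cQ0 Q : 0 <= cQ Q by rewrite mulr_ge0.
have D0 Q : 0 <= D Q.
  by have := M00 Q; have := cQ0 Q; rewrite /D; move: (M0 Q) (cQ Q) => ? ?; lra.
have dev (Q : nat) : exists a : R -> R, \forall x \ae P, \forall n \near \oo,
    forall q, `|q| <= Q%:R ->
      `|Z q n x - n%:R * a q| <= D Q * (n%:R `^ (3 / 4) * ln n%:R).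
  have qZQ q : `|q| <= Q%:R -> quasi_additive P (cQ Q) (Z q).
    by move=> qQ; apply: quasi_additive_le (qZ q); rewrite ler_wpM2r.
  have bZ q : `|q| <= Q%:R ->
      forall n, (0 < n)%N -> \forall x \ae P, `|Z q n x| <= n%:R * M0 Q.
    move=> qQ n n0; move: path; apply: filterS => x px.
    apply: le_trans (ln_partition_sum_bound px (m1 x) n q) _.
    by rewrite ler_wpM2l// lerD2l ler_wpM2l.
  have lZ : \forall x \ae P, forall n q q', (0 < n)%N ->
      `|Z q n x - Z q' n x| <= n%:R * (- ln c * `|q - q'|).
    move: path; apply: filterS => x px n q q' _.
    exact: (ln_partition_sum_lip px (m1 x)).
  have [a ha] := uniform_deviation mZ (M00 Q) (cQ0 Q) lnc qZQ bZ lZ.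
  by exists a; move: ha; apply: filterS => x [p [_ hp]]; exists p.
have /choice[a aP] := dev.
have {}aP := ae_foralln aP.
apply: filterS2 (filterI path aP) (filterI htau hmuq) => x [px ax] [taux muqx] q _.
apply: (gibbs_limit_singularity_sets px hell (muqx q) N tau_derivable
  (tau_derivable2 q) eps_gt0 eps_cvg0 hseries).
move=> Q; exists (D Q); split => //.
have a_tau q' : `|q'| <= Q%:R -> a Q q' = - (tau q' * ln b%:R).
  move=> q'Q; apply: (tau_of_limit (r := fun n => eps n * eps n) (taux q')).
    by rewrite -[0](mulr0 0); exact: cvgM.
  have D1 : 0 < D Q + 1 by rewrite ltr_wpDl.
  have rs := rate_small hb hseries D1.
  move: (ax Q) rs (nbhs_infty_ge 1); apply: filterS3 => n an rn n1.
  apply: le_trans (an q' q'Q) _; apply: le_trans rn.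
  by rewrite ler_wpM2r ?lerDl// mulr_ge0 ?powR_ge0// ln_ge0// ler1n.
move: (ax Q); apply: filterS => n an q' q'Q.
have := an q' q'Q; rewrite a_tau// mulrN opprK; exact.
Qed.
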